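(* Let $T$ be an automorphism of a standard probability Borel space $(X,\mathcal{B},\mu)$, $G$ a second countable locally compact Abelian group, $\varphi:X\to G$ a measurable map, $\mathcal{S}=(S_g)_{g\in G}$ a $G$-action on a standard probability Borel space $(Y,\mathcal{C},\nu)$, and $T_{\varphi,\mathcal{S}}(x,y)=(Tx,S_{\varphi(x)}(y))$ on $(X\times Y,\mathcal{B}\otimes\mathcal{C},\mu\otimes\nu)$. Then $T_{\varphi,\mathcal{S}}$ is relatively weakly mixing over $T$ if and only if $T_{\varphi,\mathcal{S}}$ is ergodic and $\mathcal{S}$ is weakly mixing.
   Context: An automorphism is an invertible measure-preserving transformation. A $G$-action is a measurable group homomorphism $g\mapsto S_g\in\mathrm{Aut}(Y,\mathcal{C},\nu)$. $\mathcal{S}$ is weakly mixing if it has no eigenfunctions in $L^2(Y,\mathcal{C},\nu)$ other than constants, an eigenfunction being a non-zero $g$ such that for some $\chi\in\widehat{G}$, $g\circ S_h=\chi(h)g$ for all $h\in G$. $T_{\varphi,\mathcal{S}}$ is relatively weakly mixing over (its factor) $T$ if the relative product of $T_{\varphi,\mathcal{S}}$ with itself over the factor $\mathcal{B}\otimes\{\emptyset,Y\}$ is ergodic; here this relative product is (isomorphic to) the automorphism $(x,y,y')\mapsto(Tx,S_{\varphi(x)}(y),S_{\varphi(x)}(y'))$ of $(X\times Y\times Y,\mu\otimes\nu\otimes\nu)$. *)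

(* Defs.v *)
From HB Require Import structures.
From mathcomp Require Import all_boot all_order all_algebra.
From mathcomp Require Import complex.
From mathcomp Require Import all_classical all_reals all_analysis.

Set Implicit Arguments.
Unset Strict Implicit.
Unset Printing Implicit Defensive.

Import Order.TTheory GRing.Theory Num.Theory.
Import numFieldNormedType.Exports.

Local Open Scope classical_set_scope.
Local Open Scope ring_scope.

(* [measurableType] requires a base point, which [topologicalZmodType] does not
   provide: this alias of G is pointed at 0. *)
Definition pointed_group (G : topologicalZmodType) : Type := G.
HB.instance Definition _ (G : topologicalZmodType) :=
  gen_eqMixin (pointed_group G).
HB.instance Definition _ (G : topologicalZmodType) :=
  gen_choiceMixin (pointed_group G).
HB.instance Definition _ (G : topologicalZmodType) :=
  isPointed.Build (pointed_group G) (0 : G).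

(* G with its Borel sigma-algebra *)
Notation borel G :=
  (g_sigma_algebraType (@open G : set (set (pointed_group G)))).

(* A complete pseudometric space that is Hausdorff and second countable is a
   Polish space with a chosen complete metric. *)
Definition standard_borel (R : realType) d (X : measurableType d) : Prop :=
  exists (P : completePseudoMetricType R) (f : X -> P),
    [/\ hausdorff_space P, @second_countable P, bijective f &
        forall A : set X, measurable A <-> <<s @open P >> (f @` A)].

Definition lcsc_group (G : topologicalZmodType) : Prop :=
  [/\ hausdorff_space G, locally_compact [set: G] & @second_countable G].

Section automorphisms.
Context {R : realType} {d} {X : measurableType d}.
Implicit Types (mu : probability X R) (T : X -> X).

(* As usual in Aut(X, mu), invertibility is modulo null sets; the inverse is
   then automatically measure-preserving. *)
Definition automorphism mu T : Prop :=
  [/\ measurable_fun [set: X] T,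
      forall A, measurable A -> mu (T @^-1` A) = mu A &
      exists T' : X -> X, [/\ measurable_fun [set: X] T',
        {ae mu, forall x, T' (T x) = x} & {ae mu, forall x, T (T' x) = x}]].

Definition ergodic mu T : Prop :=
  forall A, measurable A -> mu ((T @^-1` A) `+` A) = 0%E ->
    mu A = 0%E \/ mu A = 1%E.

End automorphisms.

Section actions.
Context {R : realType} {G : topologicalZmodType} {d} {Y : measurableType d}.
Implicit Types (nu : probability Y R) (S : G -> Y -> Y) (chi : G -> R[i])
  (f : Y -> R[i]).

(* A measurable homomorphism from G to Aut(Y, nu): as equality in Aut(Y, nu) is
   equality a.e., the homomorphism law is required a.e. for each pair (g, h).
   A measurable map from G to Aut(Y, nu) is given by a jointly measurable
   choice of representatives, without which (x, y) |-> S_(phi x) y would not be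
   a measurable map. *)
Definition group_action nu S : Prop :=
  [/\ forall g, automorphism nu (S g),
      forall g h, {ae nu, forall y, S (g + h) y = S g (S h y)} &
      measurable_fun [set: borel G * Y] (fun p : borel G * Y => S p.1 p.2)].

(* elements of the dual group of G; [R[i]^o] carries the topology of the
   complex plane *)
Definition character chi : Prop :=
  [/\ continuous (chi : G -> R[i]^o),
      forall g h, chi (g + h) = chi g * chi h &
      forall g, `|chi g| = 1].

Definition complex_L2 nu f : Prop :=
  (@complex.Re R \o f) \in Lfun nu 2%:E /\ (@complex.Im R \o f) \in Lfun nu 2%:E.

Definition eigenfunction nu S f : Prop :=
  [/\ complex_L2 nu f,
      ~ {ae nu, forall y, f y = 0} &
      exists2 chi, character chi &
        forall h, {ae nu, forall y, f (S h y) = chi h * f y}].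

Definition weakly_mixing nu S : Prop :=
  forall f, eigenfunction nu S f -> exists c, {ae nu, forall y, f y = c}.

End actions.

Section cocycle_extension.
Context {R : realType} {G : topologicalZmodType}.
Context {d} {X : measurableType d} {d'} {Y : measurableType d'}.
Variables (mu : probability X R) (nu : probability Y R).
Variables (T : X -> X) (phi : X -> G) (S : G -> Y -> Y).

Definition skew_product (p : X * Y) : X * Y := (T p.1, S (phi p.1) p.2).

(* The relative product of [skew_product] with itself over the factor of X,
   realized on X * Y * Y rather than on the fibred product of X * Y with
   itself. *)
Definition relative_square (p : X * Y * Y) : X * Y * Y :=
  (T p.1.1, S (phi p.1.1) p.1.2, S (phi p.1.1) p.2).

Definition relatively_weakly_mixing : Prop :=
  ergodic ((mu \x nu) \x nu)%E relative_square.

End cocycle_extension.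

(* Main.v *)
Require Import Defs.
From HB Require Import structures.
From mathcomp Require Import all_boot all_order all_algebra.
From mathcomp Require Import complex.
From mathcomp Require Import all_classical all_reals all_analysis.
From mathcomp Require Import measurable_realfun ring lra.

Set Implicit Arguments.
Unset Strict Implicit.
Unset Printing Implicit Defensive.

Import Order.TTheory GRing.Theory Num.Theory.
Import numFieldNormedType.Exports.

Local Open Scope classical_set_scope.
Local Open Scope ring_scope.

(** If f is an eigenfunction of the action, then f(y) conj f(y') is invariant under
    the relative square; and a set invariant under the skew product lifts to the
    square. This is the easy direction.

    Conversely, let the skew product be ergodic and A be a nontrivial set
    invariant under the square. View invariant bounded functions K(x, y, y') as
    fields of Hilbert-Schmidt kernels on L2(Y). By ergodicity the integrals of K
    over y or over y' are constant. With L = 1_A - c and B = L^T L, power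
    iteration yields l > 0 and a nonzero invariant K with B B K = l K. Bessel's
    inequality in almost every fibre bounds the dimension of the space of such
    K. The group G acts on this finite-dimensional space through the last
    variable (G being abelian, it commutes with the square), so there is a
    common complex eigenvector F(x, y, S_g y') = chi(g) F(x, y, y'). The
    character chi is measurable, hence continuous by a Baire category argument.
    Averages of F over (x, y) are then eigenfunctions of the action, so weak
    mixing and ergodicity make F constant; but L, hence B B, kills constants, so
    F = 0, a contradiction. *)

(** * Bounded measurable functions on probability spaces *)

Section bounded_measurable.
Context {R : realType} {d} {T : measurableType d}.
Implicit Types (f g : T -> R).

(** The obstacle is that [K (x, _, _)] is a different operator in each fibre: spectral theory fibre
    by fibre would require measurable choices of eigenvalues and eigenvectors over [X]. Ergodicity
    of the skew product avoids them. Fibrewise norms and inner products of invariant kernels do not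
    depend on the fibre, so a single number controls all fibres at once, Cauchy-Schwarz estimates of
    compositions hold pointwise almost everywhere, and the limit of the power iteration is again a
    bounded measurable kernel. Everything therefore stays within bounded functions, without
    quotients modulo null sets. L is centred so that constants are in its kernel, which is what the
    final contradiction needs. L^T L replaces L because it is symmetric and vanishes only if L does.
    Only even powers of B are iterated: for a symmetric operator, eigenvalues of opposite signs
    could make the odd ones oscillate, and so the eigenvalue equation is obtained for B B. Kernels
    are real throughout; a complex kernel occurs only as the pair of its real and imaginary
    parts. *)

Definition bounded_measurable f : Prop :=
  measurable_fun [set: T] f /\ exists M : R, forall x, `|f x| <= M.

Lemma bmeas_cst c : bounded_measurable (fun=> c).
Proof. by split; [exact: measurable_cst | exists `|c|]. Qed.

Lemma bmeasD f g : bounded_measurable f -> bounded_measurable g ->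
  bounded_measurable (fun x => f x + g x).
Proof.
move=> [mf [M fM]] [mg [N gN]]; split; first exact: measurable_funD.
by exists (M + N) => x; rewrite (le_trans (ler_normD _ _))// lerD.
Qed.

Lemma bmeasM f g : bounded_measurable f -> bounded_measurable g ->
  bounded_measurable (fun x => f x * g x).
Proof.
move=> [mf [M fM]] [mg [N gN]]; split; first exact: measurable_funM.
by exists (M * N) => x; rewrite normrM ler_pM.
Qed.

Lemma bmeasZ c f : bounded_measurable f -> bounded_measurable (fun x => c * f x).
Proof. by move=> bf; apply: bmeasM => //; exact: bmeas_cst. Qed.

Lemma bmeasB f g : bounded_measurable f -> bounded_measurable g ->
  bounded_measurable (fun x => f x - g x).
Proof.
move=> bf bg; rewrite (_ : (fun x => _) = fun x => f x + (-1) * g x).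
  by apply: bmeasD => //; exact: bmeasZ.
by apply/funext => x; rewrite mulN1r.
Qed.

Lemma bmeasX f n : bounded_measurable f -> bounded_measurable (fun x => f x ^+ n).
Proof.
move=> bf; elim: n => [|n IH].
  by rewrite (_ : (fun x => _) = fun=> 1) //; exact: bmeas_cst.
rewrite (_ : (fun x => _) = fun x => f x * f x ^+ n); first exact: bmeasM.
by apply/funext => x; rewrite exprS.
Qed.

Lemma bmeas_sum n (f : 'I_n -> T -> R) : (forall i, bounded_measurable (f i)) ->
  bounded_measurable (fun x => \sum_i f i x).
Proof.
move=> bf; elim: n f bf => [|n IH] f bf.
  rewrite (_ : (fun x => _) = fun=> 0); first exact: bmeas_cst.
  by apply/funext => x; rewrite big_ord0.
rewrite (_ : (fun x => _) =
    fun x => f ord0 x + \sum_i f (lift ord0 i) x).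
  by apply: bmeasD => //; apply: IH => i; exact: bf.
by apply/funext => x; rewrite big_ord_recl.
Qed.

Lemma bmeas_comp d' (U : measurableType d') (h : U -> T) f :
  measurable_fun [set: U] h -> bounded_measurable f ->
  measurable_fun [set: U] (f \o h) /\ exists M, forall x, `|f (h x)| <= M.
Proof.
move=> mh [mf [M fM]]; split; first exact: measurableT_comp.
by exists M => x; exact: fM.
Qed.

Lemma bmeas_indic (A : set T) : measurable A -> bounded_measurable (\1_A : T -> R).
Proof.
move=> mA; split; first exact: measurable_indic.
by exists 1 => x; rewrite indicE; case: (_ \in _); rewrite ?normr1 ?normr0.
Qed.

End bounded_measurable.

Section ae_measurable.
Context {R : realType} {d} {T : measurableType d} (m : probability T R).

Lemma aeP (P : T -> Prop) : measurable [set x | P x] ->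
  {ae m, forall x, P x} <-> m [set x | ~ P x] = 0%E.
Proof.
move=> mP; have mNP : measurable [set x | ~ P x] by exact: measurableC.
by rewrite /prop_near1/= /nbhs/= /almost_everywhere; split=> /negligibleP; apply.
Qed.

Lemma measurable_eqfun (f g : T -> R) :
  measurable_fun [set: T] f -> measurable_fun [set: T] g ->
  measurable [set x | f x = g x].
Proof.
move=> mf mg; rewrite (_ : [set x | _] = (fun x => f x - g x) @^-1` [set 0]).
  rewrite -[X in measurable X]setTI.
  by apply: measurable_funB.
by apply/seteqP; split => x /=; [move=> -> ; rewrite subrr | move/subr0_eq].
Qed.

Lemma measurable_lefun (f g : T -> R) :
  measurable_fun [set: T] f -> measurable_fun [set: T] g ->
  measurable [set x | f x <= g x].
Proof.
move=> mf mg; rewrite (_ : [set x | _] = (fun x => f x - g x) @^-1` `]-oo, 0]).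
  by rewrite -[X in measurable X]setTI; apply: measurable_funB.
by apply/seteqP; split => x /=; rewrite in_itv/= subr_le0.
Qed.

Lemma ae_const (c : Prop) : {ae m, forall x : T, c} -> c.
Proof.
move=> h; apply: contrapT => nc.
have : {ae m, forall x : T, False} by apply: filterS h => x /nc.
move/aeP; rewrite (_ : [set x | False] = set0) => [/(_ measurable0)|//].
have -> : [set _ : T | ~ False] = setT by rewrite -subTset => x _ [].
by rewrite probability_setT => /eqP; rewrite onee_eq0.
Qed.

Lemma ae_ex (P : T -> Prop) : {ae m, forall x, P x} -> exists x, P x.
Proof.
move=> h; apply: contrapT => nP; apply: ae_const.
by apply: filterS h => x Px; apply: nP; exists x.
Qed.

End ae_measurable.

Section bounded_integrals.
Context {R : realType} {d} {T : measurableType d} (m : probability T R).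
Implicit Types (f g : T -> R).

Lemma bmeas_integrable f : bounded_measurable f ->
  m.-integrable [set: T] (EFin \o f).
Proof.
move=> [mf [M fM]]; apply: measurable_bounded_integrable => //.
  by rewrite -ge0_fin_numE// fin_num_measure.
exists M; split; first exact: num_real.
by move=> N MN x _; apply: le_trans (fM x) (ltW MN).
Qed.

Lemma Rint_cst c : \int[m]_x c = c :> R.
Proof. by rewrite Rintegral_cst//= probability_setT/= mulr1. Qed.

Lemma RintD f g : bounded_measurable f -> bounded_measurable g ->
  \int[m]_x (f x + g x) = \int[m]_x f x + \int[m]_x g x.
Proof. by move=> bf bg; rewrite RintegralD//; exact: bmeas_integrable. Qed.

Lemma RintB f g : bounded_measurable f -> bounded_measurable g ->
  \int[m]_x (f x - g x) = \int[m]_x f x - \int[m]_x g x.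
Proof. by move=> bf bg; rewrite RintegralB//; exact: bmeas_integrable. Qed.

Lemma RintZl c f : bounded_measurable f ->
  \int[m]_x (c * f x) = c * \int[m]_x f x.
Proof. by move=> bf; rewrite RintegralZl//; exact: bmeas_integrable. Qed.

Lemma RintZr c f : bounded_measurable f ->
  \int[m]_x (f x * c) = \int[m]_x f x * c.
Proof. by move=> bf; rewrite RintegralZr//; exact: bmeas_integrable. Qed.

Lemma Rint_sum n (f : 'I_n -> T -> R) : (forall i, bounded_measurable (f i)) ->
  \int[m]_x (\sum_i f i x) = \sum_i \int[m]_x f i x.
Proof.
move=> bf; elim: n f bf => [|n IH] f bf.
  by under eq_Rintegral do rewrite big_ord0; rewrite Rint_cst big_ord0.
under eq_Rintegral do rewrite big_ord_recl.
by rewrite RintD ?big_ord_recl ?IH//; apply: bmeas_sum => i; exact: bf.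
Qed.

Lemma Rint_ae f g : measurable_fun [set: T] f -> measurable_fun [set: T] g ->
  {ae m, forall x, f x = g x} -> \int[m]_x f x = \int[m]_x g x.
Proof.
move=> mf mg fg; congr fine; apply: ae_eq_integral => //.
- exact/measurable_EFinP.
- exact/measurable_EFinP.
- by apply: filterS fg => x ->.
Qed.

Lemma le_Rint f g : bounded_measurable f -> bounded_measurable g ->
  (forall x, f x <= g x) -> \int[m]_x f x <= \int[m]_x g x.
Proof.
by move=> bf bg fg; apply: le_Rintegral => //; exact: bmeas_integrable.
Qed.

Lemma le_Rint_ae f g : bounded_measurable f -> bounded_measurable g ->
  {ae m, forall x, f x <= g x} -> \int[m]_x f x <= \int[m]_x g x.
Proof.
move=> bf bg fg.
have bh : bounded_measurable (fun x => Num.min (f x) (g x)).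
  case: bf bg => [mf [M fM]] [mg [N gN]]; split; first exact: measurable_minr.
  exists (M + N) => x; have := fM x; have := gN x.
  have := normr_ge0 (f x); have := normr_ge0 (g x).
  by rewrite minEle; case: ifP => _; lra.
rewrite (_ : \int[m]_x f x = \int[m]_x (Num.min (f x) (g x))).
  by apply: le_Rint => // x; rewrite ge_min lexx orbT.
apply: Rint_ae => //; [exact: bf.1|exact: bh.1|].
by apply: filterS fg => x ?; rewrite min_l.
Qed.

Lemma ler_norm_Rint_ae f (M : R) : bounded_measurable f ->
  {ae m, forall x, `|f x| <= M} -> `|\int[m]_x f x| <= M.
Proof.
move=> bf fM; rewrite ler_norml; apply/andP; split.
  rewrite -[leLHS]Rint_cst; apply: le_Rint_ae => //; first exact: bmeas_cst.
  by apply: filterS fM => x; rewrite ler_norml => /andP[].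
rewrite -[leRHS]Rint_cst; apply: le_Rint_ae => //; first exact: bmeas_cst.
by apply: filterS fM => x; rewrite ler_norml => /andP[].
Qed.

Lemma ler_norm_Rint f (M : R) : bounded_measurable f ->
  (forall x, `|f x| <= M) -> `|\int[m]_x f x| <= M.
Proof. by move=> bf fM; apply: ler_norm_Rint_ae => //; exact: aeW. Qed.

Lemma Rint_sqr_ge0 f : 0 <= \int[m]_x (f x ^+ 2).
Proof. by apply: Rintegral_ge0 => x _; exact: sqr_ge0. Qed.

Lemma ae_zeroP f : bounded_measurable f -> (forall x, 0 <= f x) ->
  {ae m, forall x, f x = 0} <-> \int[m]_x f x = 0.
Proof.
move=> bf f0; split=> [h|If0].
  rewrite -[RHS](Rint_cst 0); apply: Rint_ae => //; exact: bf.1.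
have mf : measurable_fun [set: T] (EFin \o f) by exact/measurable_EFinP/bf.1.
have /(ae_eq_integral_abs m measurableT mf) :
    (\int[m]_x `|(EFin \o f) x| = 0)%E.
  rewrite (eq_integral (EFin \o f)); last first.
    by move=> x _; rewrite gee0_abs//= lee_fin.
  rewrite -[LHS]fineK; first by congr EFin.
  by apply: integrable_fin_num => //; exact: bmeas_integrable.
by apply: filterS => x /(_ I) [].
Qed.

Lemma Rint_sqr_eq0 f : bounded_measurable f -> \int[m]_x (f x ^+ 2) = 0 ->
  {ae m, forall x, f x = 0}.
Proof.
move=> bf /(ae_zeroP (bmeasX 2 bf) (fun x => sqr_ge0 (f x))).
by apply: filterS => x /eqP; rewrite sqrf_eq0 => /eqP.
Qed.

Lemma Rint_CS f g : bounded_measurable f -> bounded_measurable g ->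
  (\int[m]_x (f x * g x)) ^+ 2 <= \int[m]_x (f x ^+ 2) * \int[m]_x (g x ^+ 2).
Proof.
move=> bf bg.
set a := \int[m]_x (f x ^+ 2); set b := \int[m]_x (g x ^+ 2).
set c := \int[m]_x (f x * g x).
have pos s t : 0 <= s ^+ 2 * a + 2 * s * t * c + t ^+ 2 * b.
  have -> : s ^+ 2 * a + 2 * s * t * c + t ^+ 2 * b =
            \int[m]_x ((s * f x + t * g x) ^+ 2).
    rewrite /a /b /c -!RintZl -?RintD;
      try (by do ?[apply: bmeasD|apply: bmeasZ|apply: bmeasX|apply: bmeasM]).
    by apply: eq_Rintegral => x _; ring.
  exact: Rint_sqr_ge0.
have a0 : 0 <= a by exact: Rint_sqr_ge0.
(* At [(c, - a)] the form equals [a * (a * b - c ^+ 2)], which settles the case [0 < a]. *)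
have := pos 0 1; have := pos 1 0; have := pos c (- a); have := pos b (- c).
have [a_gt0|] := ltP 0 a.
  move=> _ h _ _; rewrite -subr_ge0 -(pmulr_rge0 _ a_gt0).
  by apply: le_trans h _; rewrite le_eqVlt; apply/orP; left; apply/eqP; ring.
move=> a_le0; have {}a0 : a = 0 by apply/le_anti/andP.
(* With [a = 0] the form at [(- (b + 1), c)] equals [- (b + 2) * c ^+ 2], so its nonnegativity
   forces [c = 0]. *)
move=> _ _ _ b0; have := pos (- (b + 1)) c.
rewrite a0 mul0r !mulr0 add0r => h.
have bge0 : 0 <= b by move: b0; rewrite a0; lra.
have := sqr_ge0 c; nra.
Qed.

Lemma Rint_preserving (h : T -> T) f : measurable_fun [set: T] h ->
  (forall A, measurable A -> m (h @^-1` A) = m A) ->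
  bounded_measurable f -> \int[m]_x f (h x) = \int[m]_x f x.
Proof.
move=> mh hm bf.
have bfh : bounded_measurable (f \o h) by have [] := bmeas_comp mh bf.
rewrite /Rintegral; congr fine.
have -> : (\int[m]_x (f (h x))%:E =
    \int[m]_(x in h @^-1` [set: T]) ((EFin \o f) \o h) x)%E by [].
rewrite -integral_pushforward//.
- apply: eq_measure_integral => A mA _; exact: hm.
- exact/measurable_EFinP/bf.1.
- by rewrite preimage_setT; apply: bmeas_integrable.
Qed.

Lemma ae_preserving (h : T -> T) (P : T -> Prop) : measurable_fun [set: T] h ->
  (forall A, measurable A -> m (h @^-1` A) = m A) ->
  {ae m, forall x, P x} -> {ae m, forall x, P (h x)}.
Proof.
move=> mh hm [A [mA A0 PA]]; exists (h @^-1` A); split.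
- by rewrite -[X in measurable X]setTI; exact: mh.
- by rewrite hm.
- by move=> x Px; apply: PA.
Qed.

End bounded_integrals.

(** * Fubini and null sets in product spaces *)

Section product_integrals.
Context {R : realType} {d1 d2} {T1 : measurableType d1} {T2 : measurableType d2}.
Variables (m1 : probability T1 R) (m2 : probability T2 R).
Implicit Types (f : T1 * T2 -> R).

Lemma bmeas_pair1 f x : bounded_measurable f ->
  bounded_measurable (fun y => f (x, y)).
Proof. by move=> /(bmeas_comp (pair1_measurable x)). Qed.

Lemma bmeas_pair2 f y : bounded_measurable f ->
  bounded_measurable (fun x => f (x, y)).
Proof. by move=> /(bmeas_comp (pair2_measurable y)). Qed.

Lemma bmeas_Rint1 f : bounded_measurable f ->
  bounded_measurable (fun x => \int[m2]_y f (x, y)).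
Proof.
move=> bf; split.
  have := measurable_fubini_F (bmeas_integrable (m1 \x m2)%E bf).
  by move/(measurableT_comp (@fine_measurable R _ measurableT)).
have [_ [M fM]] := bf; exists M => x.
by apply: ler_norm_Rint => //; exact: bmeas_pair1.
Qed.

Lemma bmeas_Rint2 f : bounded_measurable f ->
  bounded_measurable (fun y => \int[m1]_x f (x, y)).
Proof.
move=> bf; split.
  have := measurable_fubini_G (bmeas_integrable (m1 \x m2)%E bf).
  by move/(measurableT_comp (@fine_measurable R _ measurableT)).
have [_ [M fM]] := bf; exists M => x.
by apply: ler_norm_Rint => //; exact: bmeas_pair2.
Qed.

Lemma Rint_prod1 f : bounded_measurable f ->
  \int[(m1 \x m2)%E]_p f p = \int[m1]_x \int[m2]_y f (x, y).
Proof.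
move=> bf; rewrite /Rintegral -integral12_prod_meas1; last exact: bmeas_integrable.
congr fine; apply: eq_integral => x _; rewrite /fubini_F/= fineK//.
by apply: integrable_fin_num => //; exact: bmeas_integrable (bmeas_pair1 x bf).
Qed.

Lemma Rint_prod2 f : bounded_measurable f ->
  \int[(m1 \x m2)%E]_p f p = \int[m2]_y \int[m1]_x f (x, y).
Proof.
move=> bf; rewrite /Rintegral -integral21_prod_meas1; last exact: bmeas_integrable.
congr fine; apply: eq_integral => x _; rewrite /fubini_G/= fineK//.
by apply: integrable_fin_num => //; exact: bmeas_integrable (bmeas_pair2 x bf).
Qed.

Lemma Rint_swap f : bounded_measurable f ->
  \int[m1]_x \int[m2]_y f (x, y) = \int[m2]_y \int[m1]_x f (x, y).
Proof. by move=> bf; rewrite -Rint_prod1// Rint_prod2. Qed.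

Lemma ae_zero_prodP f : bounded_measurable f -> (forall p, 0 <= f p) ->
  {ae m1, forall x, {ae m2, forall y, f (x, y) = 0}} <->
  \int[(m1 \x m2)%E]_p f p = 0.
Proof.
move=> bf f0; rewrite Rint_prod1//.
have fib x : {ae m2, forall y, f (x, y) = 0} <-> \int[m2]_y f (x, y) = 0.
  by apply: ae_zeroP => //; exact: bmeas_pair1.
have bF := bmeas_Rint1 bf.
have F0 x : 0 <= \int[m2]_y f (x, y) by exact: Rintegral_ge0.
split => [h|/(ae_zeroP m1 bF F0)]; last by apply: filterS => x /fib.
by apply/(ae_zeroP m1 bF F0); apply: filterS h => x /fib.
Qed.

Lemma indicC_eq0 T (P : T -> Prop) p : \1_(~` [set p | P p]) p = 0 :> R <-> P p.
Proof.
rewrite indicE; split => [/eqP|Pp]; last by rewrite memNset//= => /(_ Pp).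
by rewrite pnatr_eq0 eqb0 => /negP; rewrite in_setE/= => /contrapT.
Qed.

(** Both sides say that the indicator of the exceptional set, a nonnegative function, has integral
    zero over the product. *)
Lemma ae_prod (P : T1 * T2 -> Prop) : measurable [set p | P p] ->
  {ae (m1 \x m2)%E, forall p, P p} <->
  {ae m1, forall x, {ae m2, forall y, P (x, y)}}.
Proof.
move=> mP; pose n p : R := \1_(~` [set p | P p]) p.
have bn : bounded_measurable n by apply: bmeas_indic; exact: measurableC.
have n0 p : 0 <= n p by rewrite /n indicE ler0n.
split=> [h|h].
  have : {ae m1, forall x, {ae m2, forall y, n (x, y) = 0}}.
    apply/(ae_zero_prodP bn n0)/(ae_zeroP _ bn n0).
    by apply: filterS h => p /indicC_eq0.
  by apply: filterS => x; apply: filterS => y /indicC_eq0.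
have : {ae (m1 \x m2)%E, forall p, n p = 0}.
  apply/(ae_zeroP _ bn n0)/(ae_zero_prodP bn n0).
  by apply: filterS h => x; apply: filterS => y /indicC_eq0.
by apply: filterS => p /indicC_eq0.
Qed.

End product_integrals.

Lemma ae_prod_swap {R : realType} {d1 d2} {T1 : measurableType d1}
    {T2 : measurableType d2} (m1 : probability T1 R) (m2 : probability T2 R)
    (P : T1 * T2 -> Prop) : measurable [set p | P p] ->
  {ae m1, forall x, {ae m2, forall y, P (x, y)}} <->
  {ae m2, forall y, {ae m1, forall x, P (x, y)}}.
Proof.
move=> mP; pose n p : R := \1_(~` [set p | P p]) p.
have bn : bounded_measurable n by apply: bmeas_indic; exact: measurableC.
have n0 p : 0 <= n p by rewrite /n indicE ler0n.
have bn' : bounded_measurable (fun q => n (q.2, q.1)).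
  exact: (bmeas_comp (@measurable_swap _ _ T2 T1) bn).
have swap0 : \int[(m1 \x m2)%E]_p n p = 0 <->
    \int[(m2 \x m1)%E]_q n (q.2, q.1) = 0.
  by rewrite Rint_prod1// (Rint_prod2 m2 m1 bn').
split=> h.
  have : {ae m2, forall y, {ae m1, forall x, n (x, y) = 0}}.
    apply/(ae_zero_prodP m2 m1 bn' (fun q => n0 _))/swap0/(ae_zero_prodP m1 m2 bn n0).
    by apply: filterS h => x; apply: filterS => y /(indicC_eq0 (R := R)).
  by apply: filterS => y; apply: filterS => x /indicC_eq0.
have : {ae m1, forall x, {ae m2, forall y, n (x, y) = 0}}.
  apply/(ae_zero_prodP m1 m2 bn n0)/swap0/(ae_zero_prodP m2 m1 bn' (fun q => n0 _)).
  by apply: filterS h => y; apply: filterS => x /(indicC_eq0 (R := R)).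
by apply: filterS => x; apply: filterS => y /indicC_eq0.
Qed.

Section rectangles.
Context {R : realType} {d1 d2} {T1 : measurableType d1} {T2 : measurableType d2}.
Variables (m1 : probability T1 R) (m2 : probability T2 R).

(** The signed measure with density [f] vanishes on rectangles, which are stable under intersection
    and generate the product sigma-algebra; by Dynkin's argument it vanishes on every measurable
    set. *)
Lemma rectangles_eq0 (f : T1 * T2 -> R) : bounded_measurable f ->
  (forall A B, measurable A -> measurable B ->
    \int[(m1 \x m2)%E]_p (\1_A p.1 * \1_B p.2 * f p) = 0) ->
  {ae (m1 \x m2)%E, forall p, f p = 0}.
Proof.
move=> bf f0; set m := (m1 \x m2)%E.
have intf : m.-integrable [set: _] (EFin \o f) by exact: bmeas_integrable.
pose q := induced_charge intf.
have qE S : measurable S -> q S = (\int[m]_(p in S) f p)%:E.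
  move=> mS; rewrite [RHS]fineK//.
  by apply: (integrable_fin_num mS); exact: (integrableS measurableT mS).
have qT : q setT = 0%E.
  rewrite qE//; congr EFin; rewrite -[RHS](f0 setT setT)//.
  by apply: eq_Rintegral => p _; rewrite !indicT !mul1r.
have q0 S : measurable S -> q S = 0%E.
  rewrite measurable_prod_measurableType.
  apply: (@dynkin_induction _ _ _ (fun S => q S = 0%E)) => //.
  - exact: measurable_prod_measurableType.
  - move=> _ _ [A1 mA1 [B1 mB1 <-]] [A2 mA2 [B2 mB2 <-]].
    exists (A1 `&` A2); first exact: measurableI.
    exists (B1 `&` B2); first exact: measurableI.
    by rewrite setXI.
  - move=> _ [A mA [B mB <-]].
    rewrite qE; last exact: measurableX.
    congr EFin; rewrite -[RHS](f0 A B)// Rintegral_mkcond.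
    apply: eq_Rintegral => -[x y] _ /=.
    rewrite patchE !indicE in_setX/=.
    by case: (x \in A); case: (y \in B); rewrite /= ?mul1r ?mul0r.
  - move=> B mB qB; rewrite -setTD.
    transitivity (q setT - q B)%E; last by rewrite qT qB sube0.
    by rewrite -[X in (_ - q X)%E](setTI B); exact: (chargeD q measurableT mB).
  - move=> F mF tF qF.
    have := @charge_semi_sigma_additive _ _ _ q F mF tF (bigcupT_measurable _ mF).
    move=> /cvg_lim e; apply: etrans (esym (e _)) _ => //.
    apply: lim_near_cst => //; apply: nearW => n.
    by apply: big1 => i _; exact: qF.
have : ae_eq m setT (EFin \o f) (cst 0%E).
  apply: integral_ae_eq => // E _ mE.
  by rewrite integral0; exact: q0.
by apply: filterS => p /(_ I) [].
Qed.

End rectangles.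

Section ergodic_invariants.
Context {R : realType} {d} {T : measurableType d} (m : probability T R).

(** Sublevel sets of [f] are invariant modulo null sets, hence null or conull; the constant is the
    infimum of the levels that bound [f] almost everywhere. No bound on [f] is assumed, so that
    products of square-integrable eigenfunctions are covered; that the infimum is finite follows
    from [f] being real-valued. *)
Lemma ergodic_ae_const (h : T -> T) (f : T -> R) : ergodic m h ->
  measurable_fun [set: T] h -> measurable_fun [set: T] f ->
  {ae m, forall x, f (h x) = f x} -> exists c, {ae m, forall x, f x = c}.
Proof.
move=> erg mh mf fh.
have dich r : {ae m, forall x, f x <= r} \/ {ae m, forall x, r < f x}.
  pose A := [set x | f x <= r].
  have mA : measurable A by apply: measurable_lefun => //; exact: measurable_cst.
  have mhA : measurable (h @^-1` A) by rewrite -[X in measurable X]setTI; exact: mh.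
  have [] := erg A mA.
  - apply/negligibleP; first by apply: measurableU; exact: measurableD.
    apply: negligibleS fh => x /=; rewrite /A/= => + /= e.
    by rewrite e => -[] [].
  - move=> A0; right; apply/aeP.
      rewrite (_ : [set x | _] = ~` A); first exact: measurableC.
      by apply/seteqP; split => x; rewrite /A/= ltNge => /negP.
    rewrite -[RHS]A0; congr (m _); apply/seteqP; split => x; rewrite /A/= ltNge.
      by move/negP; rewrite negbK.
    by move=> ?; apply/negP; rewrite negbK.
  - move=> A1; left; apply/aeP => //.
    by rewrite (_ : [set x | _] = ~` A)// probability_setC// A1 subee.
pose E := [set r : R | {ae m, forall x, f x <= r}].
have E0 : E !=set0.
  apply: contrapT => /forallNP E0.
  have : {ae m, forall x, forall n, n%:R < f x}.
    by apply: ae_foralln => n; have [/E0|] := dich n%:R.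
  move/(ae_ex (m := m)) => [x fx]; have := fx (Num.truncn (f x)).+1.
  by rewrite ltNge ltW// truncnS_gt.
have lbE : has_lbound E.
  apply: contrapT => nlb.
  have : {ae m, forall x, forall n, f x <= - n%:R}.
    apply: ae_foralln => n; have [//|h1] := dich (- n%:R).
    exfalso; apply: nlb; exists (- n%:R) => r Er; apply: (@ae_const _ _ _ m).
    by apply: filterS2 Er h1 => x h2 h3; exact: ltW (lt_le_trans h3 h2).
  move/(ae_ex (m := m)) => [x fx]; have := fx (Num.truncn (- f x)).+1.
  by rewrite lerNr leNgt truncnS_gt.
exists (inf E).
have le1 : {ae m, forall x, forall n, f x <= inf E + n.+1%:R^-1}.
  apply: ae_foralln => n.
  have [r Er] : exists2 r, E r & r < inf E + n.+1%:R^-1.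
    by apply: inf_lt; rewrite ?ltrDl ?invr_gt0 ?ltr0n.
  by move=> rlt; apply: filterS Er => x fx; exact: le_trans fx (ltW rlt).
have ge1 : {ae m, forall x, forall n, inf E - n.+1%:R^-1 <= f x}.
  apply: ae_foralln => n.
  have [h1|] := dich (inf E - n.+1%:R^-1); last by apply: filterS => x /ltW.
  have := ge_inf lbE h1.
  by rewrite leNgt ltrBlDr ltrDl invr_gt0 ltr0n.
apply: filterS2 le1 ge1 => x fle fge; apply/le_anti/andP; split.
- apply/ler_addgt0Pr => e e0; have /= [n _ nP] := near_infty_natSinv_lt (PosNum e0).
  by apply: le_trans (fle n) _; rewrite lerD2l ltW//; exact: (nP n (leqnn n)).
- apply/ler_addgt0Pr => e e0; have /= [n _ nP] := near_infty_natSinv_lt (PosNum e0).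
  rewrite -lerBlDr; apply: le_trans (fge n).
  by rewrite lerD2l lerN2 ltW//; exact: (nP n (leqnn n)).
Qed.

End ergodic_invariants.

(** * Fibred integral kernels *)

Section kernels.
Context {R : realType} {dX} {X : measurableType dX} {dY} {Y : measurableType dY}.
Variables (mu : probability X R) (nu : probability Y R).
Implicit Types (K L : X * Y * Y -> R).
Local Notation M := ((mu \x nu) \x nu)%E.

(* [K (x, _, _)] is read as the kernel of an integral operator on functions of
   [y]: [transpose] is the adjoint, [kmul] the composition and [inner] the
   Hilbert-Schmidt inner product averaged over [x]. *)
Definition transpose K (p : X * Y * Y) : R := K (p.1.1, p.2, p.1.2).

Definition kmul K L (p : X * Y * Y) : R :=
  \int[nu]_z (K (p.1.1, p.1.2, z) * L (p.1.1, z, p.2)).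

Definition inner K L : R := \int[M]_p (K p * L p).

Lemma measurable_transpose :
  measurable_fun [set: X * Y * Y] (fun p : X * Y * Y => (p.1.1, p.2, p.1.2)).
Proof.
apply: measurable_fun_pair; last exact: measurableT_comp.
by apply: measurable_fun_pair => //; exact: measurableT_comp.
Qed.

Lemma measurable_mid (x : X) (y' : Y) :
  measurable_fun [set: Y] (fun y : Y => (x, y, y')).
Proof.
by apply: measurable_fun_pair => //; exact: pair1_measurable.
Qed.

Lemma measurable_fiber (x : X) :
  measurable_fun [set: Y * Y] (fun q : Y * Y => (x, q.1, q.2)).
Proof.
apply: measurable_fun_pair => //.
by apply: measurable_fun_pair => //; exact: measurable_cst.
Qed.

Lemma bmeas_transpose K : bounded_measurable K -> bounded_measurable (transpose K).
Proof. exact: bmeas_comp measurable_transpose. Qed.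

Lemma bmeas_mid K x y' : bounded_measurable K ->
  bounded_measurable (fun y => K (x, y, y')).
Proof. exact: bmeas_comp (measurable_mid x y'). Qed.

Lemma bmeas_fiber K x : bounded_measurable K ->
  bounded_measurable (fun q : Y * Y => K (x, q.1, q.2)).
Proof. exact: bmeas_comp (measurable_fiber x). Qed.

Lemma bmeas_integrand K L p : bounded_measurable K -> bounded_measurable L ->
  bounded_measurable (fun z => K (p.1.1, p.1.2, z) * L (p.1.1, z, p.2)).
Proof.
by move=> bK bL; apply: bmeasM; [exact: bmeas_pair1 | exact: bmeas_mid].
Qed.

Lemma bmeas_kmul K L : bounded_measurable K -> bounded_measurable L ->
  bounded_measurable (kmul K L).
Proof.
move=> bK bL.
apply: (bmeas_Rint1 M nu (f := fun q : (X * Y * Y) * Y =>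
  K (q.1.1.1, q.1.1.2, q.2) * L (q.1.1.1, q.2, q.1.2))).
have m1 : measurable_fun [set: X * Y * Y * Y] (fun q : (X * Y * Y) * Y => q.1.1.1).
  by apply: measurableT_comp => //; exact: measurableT_comp.
have m2 : measurable_fun [set: X * Y * Y * Y] (fun q : (X * Y * Y) * Y => q.1.1.2).
  by apply: measurableT_comp => //; exact: measurableT_comp.
have m3 : measurable_fun [set: X * Y * Y * Y] (fun q : (X * Y * Y) * Y => q.1.2).
  exact: measurableT_comp.
apply: bmeasM.
- apply: (bmeas_comp (h := fun q : (X * Y * Y) * Y => (q.1.1.1, q.1.1.2, q.2))) bK.
  by apply: measurable_fun_pair => //; exact: measurable_fun_pair.
- apply: (bmeas_comp (h := fun q : (X * Y * Y) * Y => (q.1.1.1, q.2, q.1.2))) bL.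
  by apply: measurable_fun_pair => //; exact: measurable_fun_pair.
Qed.

Lemma Rint_fibers K : bounded_measurable K ->
  \int[M]_p K p = \int[mu]_x \int[nu]_y \int[nu]_y' K (x, y, y').
Proof.
move=> bK; rewrite Rint_prod1//.
rewrite (Rint_prod1 mu nu (f := fun z => \int[nu]_y' K (z, y')))//.
exact: (bmeas_Rint1 (mu \x nu)%E).
Qed.

Lemma ae_fibers (P : X * Y * Y -> Prop) : measurable [set p | P p] ->
  {ae M, forall p, P p} <->
  {ae mu, forall x, {ae nu, forall y, {ae nu, forall y', P (x, y, y')}}}.
Proof.
move=> mP; pose n p : R := \1_(~` [set p | P p]) p.
have bn : bounded_measurable n by apply: bmeas_indic; exact: measurableC.
have n0 p : 0 <= n p by rewrite /n indicE ler0n.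
pose N z := \int[nu]_y' n (z, y').
have bN : bounded_measurable N by exact: (bmeas_Rint1 (mu \x nu)%E nu bn).
have N0 z : 0 <= N z by exact: Rintegral_ge0.
have IN : \int[M]_p n p = \int[(mu \x nu)%E]_z N z.
  by rewrite (Rint_prod1 (mu \x nu)%E nu bn).
have fib z : {ae nu, forall y', n (z, y') = 0} <-> N z = 0.
  by apply: ae_zeroP => //; exact: bmeas_pair1.
split=> h.
  have : {ae mu, forall x, {ae nu, forall y, N (x, y) = 0}}.
    apply/(ae_zero_prodP mu nu bN N0); rewrite -IN; apply/(ae_zeroP M bn n0).
    by apply: filterS h => p /(indicC_eq0 (R := R)).
  apply: filterS => x; apply: filterS => y /fib.
  by apply: filterS => y' /indicC_eq0.
have : {ae M, forall p, n p = 0}.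
  apply/(ae_zeroP M bn n0); rewrite IN; apply/(ae_zero_prodP mu nu bN N0).
  apply: filterS h => x; apply: filterS => y h; apply/fib.
  by apply: filterS h => y' /(indicC_eq0 (R := R)).
by apply: filterS => p /indicC_eq0.
Qed.

(** A negligible set is contained in a measurable null set, whose complement can stand in for [P];
    this direction thus holds without measurability of [P]. *)
Lemma ae_fibersW (P : X * Y * Y -> Prop) : {ae M, forall p, P p} ->
  {ae mu, forall x, {ae nu, forall y, {ae nu, forall y', P (x, y, y')}}}.
Proof.
move=> [N [mN N0 PN]].
have mNC : measurable [set p | (~` N) p] by exact: measurableC.
have : {ae M, forall p, (~` N) p} by exists N; split => // p /contrapT.
move/(ae_fibers mNC); apply: filterS => x; apply: filterS => y.
by apply: filterS => y' Nxy; apply: contrapT => h; apply: Nxy; apply: PN.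
Qed.

Lemma ae_fibers_swap (P : X * Y * Y -> Prop) x : measurable [set p | P p] ->
  {ae nu, forall y, {ae nu, forall y', P (x, y, y')}} <->
  {ae nu, forall y', {ae nu, forall y, P (x, y, y')}}.
Proof.
move=> mP; apply: (ae_prod_swap nu nu (P := fun q => P (x, q.1, q.2))).
by rewrite -[X in measurable X]setTI; exact: (measurable_fiber x).
Qed.

Lemma Rint_transpose K : bounded_measurable K ->
  \int[M]_p transpose K p = \int[M]_p K p.
Proof.
move=> bK; rewrite (Rint_fibers bK) (Rint_fibers (bmeas_transpose bK)).
apply: eq_Rintegral => x _.
by rewrite (Rint_swap nu nu (f := fun q => K (x, q.1, q.2)))//; exact: bmeas_fiber.
Qed.

Lemma kmulA K L N : bounded_measurable K -> bounded_measurable L ->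
  bounded_measurable N -> kmul (kmul K L) N = kmul K (kmul L N).
Proof.
move=> bK bL bN; apply/funext => -[[x y] y']; rewrite /kmul/=.
transitivity (\int[nu]_z \int[nu]_w (K (x, y, w) * L (x, w, z) * N (x, z, y'))).
  apply: eq_Rintegral => z _; rewrite -RintZr//.
  exact: (bmeas_integrand (x, y, z)).
transitivity (\int[nu]_w \int[nu]_z (K (x, y, w) * L (x, w, z) * N (x, z, y'))).
  rewrite (Rint_swap nu nu
    (f := fun q => K (x, y, q.2) * L (x, q.2, q.1) * N (x, q.1, y')))//.
  have m2 : measurable_fun [set: Y * Y] (fun q : Y * Y => (x, q.2, q.1)).
    apply: measurable_fun_pair => //.
    by apply: measurable_fun_pair => //; exact: measurable_cst.
  apply: bmeasM; first apply: bmeasM.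
  - exact: (bmeas_comp measurable_snd (bmeas_pair1 (x, y) bK)).
  - exact: (bmeas_comp m2 bL).
  - exact: (bmeas_comp measurable_fst (bmeas_mid x y' bN)).
apply: eq_Rintegral => w _; rewrite -RintZl//.
  by apply: eq_Rintegral => z _; rewrite mulrA.
exact: (bmeas_integrand (x, w, y')).
Qed.

Lemma transpose_kmul K L : transpose (kmul K L) = kmul (transpose L) (transpose K).
Proof.
by apply/funext => -[[x y] y']; apply: eq_Rintegral => z _; rewrite /transpose/= mulrC.
Qed.

Lemma kmulZr c K L : bounded_measurable K -> bounded_measurable L ->
  kmul K (fun p => c * L p) = fun p => c * kmul K L p.
Proof.
move=> bK bL; apply/funext => p; rewrite /kmul -RintZl; last exact: bmeas_integrand.
by apply: eq_Rintegral => z _; ring.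
Qed.

Lemma kmulBr K L N : bounded_measurable K -> bounded_measurable L ->
  bounded_measurable N ->
  kmul K (fun p => L p - N p) = fun p => kmul K L p - kmul K N p.
Proof.
move=> bK bL bN; apply/funext => p; rewrite /kmul -RintB; try exact: bmeas_integrand.
by apply: eq_Rintegral => z _; ring.
Qed.

Lemma kmul_sumr K n (L : 'I_n -> X * Y * Y -> R) : bounded_measurable K ->
  (forall i, bounded_measurable (L i)) ->
  kmul K (fun p => \sum_i L i p) = fun p => \sum_i kmul K (L i) p.
Proof.
move=> bK bL; apply/funext => p; rewrite /kmul -Rint_sum; last first.
  by move=> i; exact: bmeas_integrand.
by apply: eq_Rintegral => z _; rewrite mulr_sumr.
Qed.

Lemma innerC K L : inner K L = inner L K.
Proof. by apply: eq_Rintegral => p _; rewrite mulrC. Qed.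

Lemma innerDl K L N : bounded_measurable K -> bounded_measurable L ->
  bounded_measurable N -> inner (fun p => K p + L p) N = inner K N + inner L N.
Proof.
move=> bK bL bN; rewrite /inner -RintD; try exact: bmeasM.
by apply: eq_Rintegral => p _; rewrite mulrDl.
Qed.

Lemma innerBl K L N : bounded_measurable K -> bounded_measurable L ->
  bounded_measurable N -> inner (fun p => K p - L p) N = inner K N - inner L N.
Proof.
move=> bK bL bN; rewrite /inner -RintB; try exact: bmeasM.
by apply: eq_Rintegral => p _; rewrite mulrBl.
Qed.

Lemma innerZl c K L : bounded_measurable K -> bounded_measurable L ->
  inner (fun p => c * K p) L = c * inner K L.
Proof.
move=> bK bL; rewrite /inner -RintZl; last exact: bmeasM.
by apply: eq_Rintegral => p _; rewrite mulrA.
Qed.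

Lemma inner_suml n (K : 'I_n -> X * Y * Y -> R) L :
  (forall i, bounded_measurable (K i)) -> bounded_measurable L ->
  inner (fun p => \sum_i K i p) L = \sum_i inner (K i) L.
Proof.
move=> bK bL; rewrite /inner -Rint_sum; last by move=> i; exact: bmeasM.
by apply: eq_Rintegral => p _; rewrite mulr_suml.
Qed.

Lemma inner_CS K L : bounded_measurable K -> bounded_measurable L ->
  inner K L ^+ 2 <= inner K K * inner L L.
Proof. by move=> bK bL; exact: Rint_CS. Qed.

Lemma inner_ge0 K : 0 <= inner K K.
Proof. exact: Rint_sqr_ge0. Qed.

Lemma inner_eq0 K : bounded_measurable K -> inner K K = 0 ->
  {ae M, forall p, K p = 0}.
Proof. by move=> bK; exact: Rint_sqr_eq0. Qed.

Lemma inner_ae K K' L L' : bounded_measurable K -> bounded_measurable K' ->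
  bounded_measurable L -> bounded_measurable L' ->
  {ae M, forall p, K p = K' p} -> {ae M, forall p, L p = L' p} ->
  inner K L = inner K' L'.
Proof.
move=> bK bK' bL bL' KK' LL'; apply: Rint_ae; try by apply: (bmeasM _ _).1.
by apply: filterS2 KK' LL' => p -> ->.
Qed.

Lemma inner_kmull A K L : bounded_measurable A -> bounded_measurable K ->
  bounded_measurable L -> inner (kmul A K) L = inner K (kmul (transpose A) L).
Proof.
move=> bA bK bL; have bA' := bmeas_transpose bA.
have bAK := bmeas_kmul bA bK; have bAL := bmeas_kmul bA' bL.
have b1 := bmeasM bAK bL; have b2 := bmeasM bK bAL.
rewrite /inner -(Rint_transpose b1) -(Rint_transpose b2).
rewrite (Rint_fibers (bmeas_transpose b1)) (Rint_fibers (bmeas_transpose b2)).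
apply: eq_Rintegral => x _; apply: eq_Rintegral => y' _; rewrite /transpose/=.
transitivity (\int[nu]_y \int[nu]_z (A (x, y, z) * K (x, z, y') * L (x, y, y'))).
  apply: eq_Rintegral => y _; rewrite -RintZr//.
  exact: (bmeas_integrand (x, y, y')).
rewrite (Rint_swap nu nu
  (f := fun q => A (x, q.1, q.2) * K (x, q.2, y') * L (x, q.1, y'))) /=.
  apply: eq_Rintegral => z _; rewrite -RintZl.
    by apply: eq_Rintegral => y _; rewrite /transpose/=; ring.
  exact: (bmeas_integrand (x, z, y') bA' bL).
apply: bmeasM; first apply: bmeasM.
- exact: bmeas_fiber.
- exact: (bmeas_comp measurable_snd (bmeas_mid x y' bK)).
- exact: (bmeas_comp measurable_fst (bmeas_mid x y' bL)).
Qed.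

End kernels.

(** * Kernels invariant under the relative square *)

Section invariant_kernels.
Context {R : realType} {dX} {X : measurableType dX} {dY} {Y : measurableType dY}.
Variables (mu : probability X R) (nu : probability Y R).
Variables (T : X -> X) (s : X -> Y -> Y).
Hypotheses (ms : forall x, measurable_fun [set: Y] (s x))
  (s_nu : forall x A, measurable A -> nu (s x @^-1` A) = nu A).
Hypothesis mskew : measurable_fun [set: X * Y] (fun p => (T p.1, s p.1 p.2)).
Local Notation M := ((mu \x nu) \x nu)%E.
Local Notation square :=
  (fun p : X * Y * Y => (T p.1.1, s p.1.1 p.1.2, s p.1.1 p.2)).
Implicit Types (K L : X * Y * Y -> R).

(* Nested a.e. quantifiers do not require the exceptional set to be jointly
   measurable: S_g and S_(phi x) commute only off a null set depending on x. *)
Definition invariant_kernel K : Prop := bounded_measurable K /\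
  {ae mu, forall x, {ae nu, forall y, {ae nu, forall y',
     K (square (x, y, y')) = K (x, y, y')}}}.

Lemma measurable_square : measurable_fun [set: X * Y * Y] square.
Proof.
have m1 : measurable_fun [set: X * Y * Y] (fun p : X * Y * Y => (p.1.1, p.2)).
  by apply: measurable_fun_pair => //; exact: measurableT_comp.
have := measurableT_comp measurable_fst mskew => mT.
have := measurableT_comp measurable_snd mskew => mS.
apply: measurable_fun_pair; first exact: (measurableT_comp mskew measurable_fst).
exact: (measurableT_comp mS m1).
Qed.

Lemma invariant_ae K : invariant_kernel K ->
  {ae M, forall p, K (square p) = K p}.
Proof.
move=> [bK iK]; apply/(ae_fibers mu nu (P := fun p => K (square p) = K p)) => //.
apply: measurable_eqfun; last exact: bK.1.
exact: (measurableT_comp bK.1 measurable_square).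
Qed.

Lemma invariant_swap K : invariant_kernel K ->
  {ae mu, forall x, {ae nu, forall y', {ae nu, forall y,
     K (square (x, y, y')) = K (x, y, y')}}}.
Proof.
move=> [bK iK]; apply: filterS iK => x.
suff mP : measurable [set p | K (square p) = K p].
  by move=> h; apply/(ae_fibers_swap nu x mP).
apply: measurable_eqfun; last exact: bK.1.
exact: (measurableT_comp bK.1 measurable_square).
Qed.

Lemma invariant_of_ae K : bounded_measurable K ->
  {ae M, forall p, K (square p) = K p} -> invariant_kernel K.
Proof. by move=> bK /ae_fibersW. Qed.

Lemma invariant_cst c : invariant_kernel (fun=> c).
Proof. by split; [exact: bmeas_cst|apply: aeW => x; apply: aeW => y; exact: aeW]. Qed.

Lemma invariant_op2 (op : R -> R -> R) K L :
  bounded_measurable (fun p => op (K p) (L p)) ->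
  invariant_kernel K -> invariant_kernel L ->
  invariant_kernel (fun p => op (K p) (L p)).
Proof.
move=> bKL [_ iK] [_ iL]; split => //.
apply: filterS2 iK iL => x; apply: filterS2 => y; apply: filterS2 => y' <- <-.
by [].
Qed.

Lemma invariantD K L : invariant_kernel K -> invariant_kernel L ->
  invariant_kernel (fun p => K p + L p).
Proof.
move=> iK iL; apply: invariant_op2 => //.
by apply: bmeasD; [exact: iK.1|exact: iL.1].
Qed.

Lemma invariantB K L : invariant_kernel K -> invariant_kernel L ->
  invariant_kernel (fun p => K p - L p).
Proof.
move=> iK iL; apply: (invariant_op2 (op := fun a b => a - b)) => //.
by apply: bmeasB; [exact: iK.1|exact: iL.1].
Qed.

Lemma invariantM K L : invariant_kernel K -> invariant_kernel L ->
  invariant_kernel (fun p => K p * L p).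
Proof.
move=> iK iL; apply: invariant_op2 => //.
by apply: bmeasM; [exact: iK.1|exact: iL.1].
Qed.

Lemma invariantZ c K : invariant_kernel K -> invariant_kernel (fun p => c * K p).
Proof. by move=> iK; apply: invariantM => //; exact: invariant_cst. Qed.

Lemma invariant_sum n (K : 'I_n -> X * Y * Y -> R) :
  (forall i, invariant_kernel (K i)) -> invariant_kernel (fun p => \sum_i K i p).
Proof.
move=> iK; elim: n K iK => [|n IH] K iK.
  rewrite (_ : (fun p => _) = fun=> 0); first exact: invariant_cst.
  by apply/funext => x; rewrite big_ord0.
rewrite (_ : (fun x => _) = fun x => K ord0 x + \sum_i K (lift ord0 i) x).
  by apply: invariantD => //; apply: IH => i; exact: iK.
by apply/funext => x; rewrite big_ord_recl.
Qed.

Lemma invariant_transpose K : invariant_kernel K -> invariant_kernel (transpose K).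
Proof.
move=> iK; split; first by apply: bmeas_transpose; exact: iK.1.
by have := invariant_swap iK.
Qed.

(** The substitution of [s x z] for the integrated variable [z] preserves [nu] and brings both
    factors into the position where their invariance applies. The factor [L] is used for almost
    every last variable and then almost every middle one, hence [invariant_swap]. *)
Lemma invariant_kmul K L : invariant_kernel K -> invariant_kernel L ->
  invariant_kernel (kmul nu K L).
Proof.
move=> [bK iK] iL; have [bL _] := iL; split; first exact: (bmeas_kmul mu).
apply: filterS2 iK (invariant_swap iL) => x hK hL.
apply: filterS hK => y hK; apply: filterS hL => y' hL; rewrite /kmul/=.
rewrite -(Rint_preserving (ms x) (s_nu x)
  (f := fun z => K (T x, s x y, z) * L (T x, z, s x y'))); last first.
  exact: (bmeas_integrand (T x, s x y, s x y')).
apply: Rint_ae.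
- apply: (measurableT_comp (f := fun z => K (T x, s x y, z) * L (T x, z, s x y'))) (ms x).
  exact: (bmeas_integrand (T x, s x y, s x y') bK bL).1.
- exact: (bmeas_integrand (x, y, y') bK bL).1.
- by apply: filterS2 hK hL => z /= -> ->.
Qed.

Hypothesis erg : ergodic (mu \x nu)%E (fun p => (T p.1, s p.1 p.2)).

(** As [s x] preserves [nu], integrating out the last variable leaves a function on [X * Y]
    invariant under the skew product; the constant it equals can only be the total integral. *)
Lemma fiber_last K : invariant_kernel K ->
  {ae (mu \x nu)%E, forall z, \int[nu]_y' K (z, y') = \int[M]_p K p}.
Proof.
move=> [bK iK]; pose f z := \int[nu]_y' K (z, y').
have bf : bounded_measurable f by exact: (bmeas_Rint1 (mu \x nu)%E nu bK).
have [c fc] : exists c, {ae (mu \x nu)%E, forall z, f z = c}.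
  apply: (ergodic_ae_const erg) => //; first exact: bf.1.
  apply/(ae_prod mu nu (P := fun z => f (T z.1, s z.1 z.2) = f z)).
    apply: measurable_eqfun; last exact: bf.1.
    exact: (measurableT_comp bf.1 mskew).
  apply: filterS iK => x; apply: filterS => y h; rewrite /f/=.
  rewrite -(Rint_preserving (ms x) (s_nu x)
    (f := fun z => K (T x, s x y, z))); last exact: bmeas_pair1.
  apply: Rint_ae => //.
    apply: (measurableT_comp (f := fun z => K (T x, s x y, z))) (ms x).
    exact: (bmeas_pair1 _ bK).1.
  exact: (bmeas_pair1 (x, y) bK).1.
suff -> : \int[M]_p K p = c by [].
rewrite Rint_prod1// -[RHS](Rint_cst (mu \x nu)%E c); apply: Rint_ae => //.
exact: bf.1.
Qed.

Lemma fiber_lastP K : invariant_kernel K -> {ae mu, forall x, {ae nu, forall y,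
  \int[nu]_y' K (x, y, y') = \int[M]_p K p}}.
Proof.
move=> iK; have [bK _] := iK.
apply/(ae_prod mu nu (P := fun z => \int[nu]_y' K (z, y') = \int[M]_p K p)).
  apply: measurable_eqfun; last exact: measurable_cst.
  exact: (bmeas_Rint1 (mu \x nu)%E nu bK).1.
exact: fiber_last.
Qed.

Lemma fiber_midP K : invariant_kernel K -> {ae mu, forall x, {ae nu, forall y',
  \int[nu]_y K (x, y, y') = \int[M]_p K p}}.
Proof.
move=> iK; have [bK _] := iK.
by have := fiber_lastP (invariant_transpose iK); rewrite (Rint_transpose mu nu bK).
Qed.

(* Ergodicity makes the fibrewise L2 norms constant, so that Hilbert-Schmidt
   bounds become pointwise ones. *)
Lemma kmul_bound A K : invariant_kernel A -> invariant_kernel K ->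
  {ae M, forall p, kmul nu A K p ^+ 2 <= inner mu nu A A * inner mu nu K K}.
Proof.
move=> iA iK; have [[bA _] [bK _]] := (iA, iK).
apply/(ae_fibers mu nu (P := fun p => kmul nu A K p ^+ 2 <= _)).
  apply: measurable_lefun; last exact: measurable_cst.
  by apply: measurable_funX; exact: (bmeas_kmul mu nu bA bK).1.
apply: filterS2 (fiber_lastP (invariantM iA iA)) (fiber_midP (invariantM iK iK)).
move=> x hA hK; apply: filterS hA => y hA; apply: filterS hK => y' hK.
rewrite /inner -hA -hK.
by apply: Rint_CS; [exact: bmeas_pair1|exact: bmeas_mid].
Qed.

Lemma inner_kmul_le A K : invariant_kernel A -> invariant_kernel K ->
  inner mu nu (kmul nu A K) (kmul nu A K) <= inner mu nu A A * inner mu nu K K.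
Proof.
move=> iA iK; have [[bA _] [bK _]] := (iA, iK).
have bAK := bmeas_kmul mu nu bA bK.
rewrite -[leRHS](Rint_cst M); apply: le_Rint_ae.
- exact: bmeasM.
- exact: bmeas_cst.
- by apply: filterS (kmul_bound iA iK) => p; rewrite expr2.
Qed.

End invariant_kernels.

(** * An eigenkernel by power iteration *)

Section growth_rate.
Context {R : realType}.

Lemma bernoulli_le (x : R) n : 0 <= x <= 1 -> 1 - n%:R * x <= (1 - x) ^+ n.
Proof.
move=> /andP[x0 x1]; elim: n => [|n IH]; first by rewrite mul0r subr0 expr0.
rewrite exprS; apply: (le_trans (y := (1 - x) * (1 - n%:R * x))).
  rewrite -subr_ge0 -natr1 (_ : _ - _ = n%:R * x ^+ 2); last by ring.
  by rewrite mulr_ge0// sqr_ge0.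
by rewrite ler_wpM2l// subr_ge0.
Qed.

(** Here [e n] stands for the squared norm of the power A^(n+1), whence the exponents [n.+1].
    Log-convexity makes the ratios [e n.+1 / e n] nondecreasing, submultiplicativity bounds them by
    [e 0], and [l] is their supremum. The lower bound 1 will keep the limit of the normalized powers
    from vanishing. *)
Lemma growth_rate (e : nat -> R) : (forall n, 0 < e n) ->
  (forall n, e n.+1 ^+ 2 <= e n * e n.+2) ->
  (forall n m, e (n + m).+1 <= e n * e m) ->
  exists2 l, 0 < l &
    forall n, e n.+1 / l ^+ n.+2 <= e n / l ^+ n.+1 /\ 1 <= e n / l ^+ n.+1.
Proof.
move=> e0 elc esub; pose r n := e n.+1 / e n.
have r_gt0 n : 0 < r n by rewrite divr_gt0.
have r_le n : r n <= r n.+1.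
  by rewrite ler_pdivlMr// mulrAC ler_pdivrMr// -expr2 mulrC elc.
have r_mono n m : (n <= m)%N -> r n <= r m.
  elim: m => [|m IH]; first by rewrite leqn0 => /eqP->.
  by rewrite leq_eqVlt ltnS => /predU1P[->//|/IH/le_trans]; apply.
have rub : has_ubound (range r).
  exists (e 0%N) => _ [n _ <-]; rewrite ler_pdivrMr// mulrC.
  by have := esub n 0%N; rewrite addn0.
pose l := sup (range r).
have rl n : r n <= l by apply: ub_le_sup => //; exists n.
have l0 : 0 < l by exact: lt_le_trans (r_gt0 0%N) (rl 0%N).
exists l => //; pose s n := e n / l ^+ n.+1.
have s_gt0 n : 0 < s n by rewrite divr_gt0// exprn_gt0.
have sS n : s n.+1 = s n * (r n / l).
  rewrite /s /r exprSr; field; rewrite gt_eqF//= expf_neq0 ?gt_eqF//.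
have s_le n : s n.+1 <= s n.
  by rewrite sS ger_pMr// ler_pdivrMr// mul1r.
have s_sub n m : s (n + m).+1 <= s n * s m.
  rewrite /s mulrACA -invfM -exprD addSn addnS ler_pM2r ?invr_gt0 ?exprn_gt0//.
move=> n; split; first exact: s_le.
rewrite -/(s n) leNgt; apply/negP => sn1.
(* The number [x m] is the relative gap between [r m] and [l]. If [s n < 1], submultiplicativity
   shrinks [s] at least by the factor [s n] over any [n.+1] steps; as the ratios increase,
   Bernoulli's inequality then bounds every gap below by [(1 - s n) / n.+1], which keeps the ratios
   away from their supremum. *)
pose x m := 1 - r m / l.
have x01 m : 0 <= x m <= 1.
  rewrite /x subr_ge0 ler_pdivrMr// mul1r rl/= lerBlDr lerDl.
  by rewrite divr_ge0// ltW.
have key m k : s m * (1 - x m) ^+ k <= s (m + k)%N.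
  elim: k => [|k IH]; first by rewrite expr0 mulr1 addn0.
  rewrite exprSr mulrA addnS sS; apply: ler_pM => //.
  - apply: mulr_ge0; first exact: ltW.
    by rewrite exprn_ge0// subr_ge0; case/andP: (x01 m).
  - by rewrite subr_ge0; case/andP: (x01 m).
  - by rewrite /x opprB addrC subrK ler_pM2r ?invr_gt0// r_mono// leq_addr.
have xlb m : (1 - s n) / n.+1%:R <= x m.
  rewrite ler_pdivrMr ?ltr0n//.
  have := le_trans (ler_wpM2l (ltW (s_gt0 m)) (bernoulli_le n.+1 (x01 m))) (key m n.+1).
  rewrite addnS => /le_trans/(_ (s_sub _ _)); rewrite ler_pM2l//; lra.
have : l <= l * (1 - (1 - s n) / n.+1%:R).
  apply: ge_sup; first by exists (r 0%N), 0%N.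
  move=> _ [m _ <-]; rewrite [leRHS]mulrC -ler_pdivrMr//.
  by rewrite lerBrDr addrC -lerBrDr; exact: xlb.
rewrite ler_pMr// lerBrDr gerDl.
by apply/negP; rewrite -ltNge divr_gt0 ?ltr0n// subr_gt0.
Qed.

End growth_rate.

Section eigenkernel.
Context {R : realType} {dX} {X : measurableType dX} {dY} {Y : measurableType dY}.
Variables (mu : probability X R) (nu : probability Y R).
Variables (T : X -> X) (s : X -> Y -> Y).
Hypotheses (ms : forall x, measurable_fun [set: Y] (s x))
  (s_nu : forall x A, measurable A -> nu (s x @^-1` A) = nu A).
Hypothesis mskew : measurable_fun [set: X * Y] (fun p => (T p.1, s p.1 p.2)).
Hypothesis erg : ergodic (mu \x nu)%E (fun p => (T p.1, s p.1 p.2)).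
Local Notation M := ((mu \x nu) \x nu)%E.
Local Notation square :=
  (fun p : X * Y * Y => (T p.1.1, s p.1.1 p.1.2, s p.1.1 p.2)).
Local Notation invariant := (invariant_kernel mu nu T s).
Local Notation "<< K , L >>" := (inner mu nu K L).
Local Notation "K ** L" := (kmul nu K L) (at level 40, left associativity).
Implicit Types (K L : X * Y * Y -> R).

Variable A : X * Y * Y -> R.
Hypotheses (iA : invariant A) (symA : transpose A = A).
Hypotheses (A_gt0 : 0 < <<A, A>>) (AA_gt0 : 0 < <<A ** A, A ** A>>).

Let bA : bounded_measurable A := iA.1.

(* The index is shifted: [kpow n] is the power A^(n+1). *)
Fixpoint kpow n := if n is n'.+1 then A ** kpow n' else A.

Lemma kpow_invariant n : invariant (kpow n).
Proof. by elim: n => [//|n IH]; exact: invariant_kmul. Qed.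

Lemma kpow_bmeas n : bounded_measurable (kpow n).
Proof. exact: (kpow_invariant n).1. Qed.

Lemma kpowD n m : kpow n ** kpow m = kpow (n + m).+1.
Proof.
elim: n => [//|n IH]; transitivity (A ** (kpow n ** kpow m)); last by rewrite IH.
by apply: kmulA => //; exact: kpow_bmeas.
Qed.

Lemma inner_kpow_shift i j : <<kpow i.+1, kpow j>> = <<kpow i, kpow j.+1>>.
Proof. by rewrite /= inner_kmull ?symA//; exact: kpow_bmeas. Qed.

(** Since [A] is symmetric, its factors move across the inner product, which depends on the sum of
    the exponents only. *)
Lemma inner_kpow i j : <<kpow i, kpow (i + j.*2)>> = <<kpow (i + j), kpow (i + j)>>.
Proof.
elim: j i => [|j IH] i; first by rewrite !addn0.
rewrite doubleS (_ : i + j.*2.+2 = (i.+1 + j.*2).+1)%N; last by rewrite !addnS.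
by rewrite -(inner_kpow_shift i (i.+1 + j.*2)) IH addSnnS.
Qed.

Let e n := <<kpow n, kpow n>>.

Lemma kpow_rate : exists2 l : R, 0 < l &
  forall n, e n.+1 / l ^+ n.+2 <= e n / l ^+ n.+1 /\ 1 <= e n / l ^+ n.+1.
Proof.
have elc n : e n.+1 ^+ 2 <= e n * e n.+2.
  have := inner_CS mu nu (kpow_bmeas n) (kpow_bmeas n.+2).
  by have := inner_kpow n 1; rewrite addn2 addn1 => ->.
apply: growth_rate => //; last first.
  move=> n m; rewrite /e -kpowD.
  by apply: (inner_kmul_le ms s_nu mskew erg); exact: kpow_invariant.
(* By [elc], two consecutive positive terms force the next one to be positive, so [A_gt0] and
   [AA_gt0] suffice. *)
suff h n : 0 < e n /\ 0 < e n.+1 by move=> n; case: (h n).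
elim: n => [|n [en en1]]; first by split; [exact: A_gt0|exact: AA_gt0].
split; first exact: en1.
by rewrite -(pmulr_rgt0 _ en) (lt_le_trans _ (elc n))// exprn_gt0.
Qed.

(* The normalized powers A^(2n+2) / l^(n+1) are Cauchy for [inner], hence almost
   everywhere uniformly Cauchy by [kmul_bound]; their limit is the eigenkernel. *)
Lemma eigenkernel_exists : exists2 l : R, 0 < l & exists P, [/\ invariant P,
  {ae M, forall p, (A ** A ** P) p = l * P p} & ~ {ae M, forall p, P p = 0}].
Proof.
have [l l0 rate] := kpow_rate; exists l => //.
pose sg n := e n / l ^+ n.+1.
have sg_le n m : (n <= m)%N -> sg m <= sg n.
  elim: m => [|m IH]; first by rewrite leqn0 => /eqP->.
  rewrite leq_eqVlt ltnS => /predU1P[->//|/IH]; apply: le_trans.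
  exact: (rate m).1.
have sg1 n : 1 <= sg n by exact: (rate n).2.
pose b n := fun p => (l ^+ n.+1)^-1 * kpow n.*2.+1 p.
have ib n : invariant (b n) by apply: invariantZ; exact: kpow_invariant.
have bb n : bounded_measurable (b n) by exact: (ib n).1.
(* With this formula the squared norm of a difference of two [b n] becomes a combination of values
   of the nonincreasing sequence [sg]. *)
have inner_b n k : <<b n, b (n + k)%N>> = sg (n + (n + k)).+1.
  have bk m : bounded_measurable (kpow m) by exact: kpow_bmeas.
  rewrite innerZl// innerC innerZl// innerC.
  have -> : (n + k).*2.+1 = (n.*2.+1 + k.*2)%N by rewrite doubleD.
  rewrite inner_kpow /sg /e (_ : n.*2.+1 + k = (n + (n + k)).+1)%N; last first.
    by rewrite addSn -addnn addnA.
  rewrite mulrA -invfM -exprD mulrC; congr (_ / _ ^+ _).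
  by rewrite addSn addnS.
set A2 := A ** A.
have iA2 : invariant A2 by exact: (kpow_invariant 1).
have bA2 : bounded_measurable A2 := iA2.1.
have b_rec n : A2 ** b n = fun p => l * b n.+1 p.
  rewrite /b kmulZr//; last exact: kpow_bmeas.
  rewrite /A2 kmulA//; last exact: kpow_bmeas.
  apply/funext => p; rewrite mulrA; congr (_ * _).
  by rewrite [l ^+ n.+2]exprS invfM mulVKf// gt_eqF.
clearbody b sg A2.
have l_neq0 : l != 0 by rewrite gt_eqF.
pose slim := inf (range (fun n => sg n.*2.+1)).
have sg_lb : has_lbound (range (fun n => sg n.*2.+1)) by exists 1 => _ [n _ <-].
have slim_le n : slim <= sg n.*2.+1 by apply: ge_inf => //; exists n.
(* For [m >= n] the squared norm of [b n - b m] is at most [sg n.*2.+1 - slim]. Applying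
   [kmul_bound] to [A2] and this difference bounds [l * (b n.+1 - b m.+1)] pointwise: this yields
   [C], and explains why [dl n] controls the kernels from index [n.+1] on. *)
pose C := l ^- 2 * <<A2, A2>>.
have C0 : 0 <= C by rewrite mulr_ge0 ?inner_ge0// invr_ge0 exprn_ge0// ltW.
pose dl n := Num.sqrt (C * (sg n.*2.+1 - slim)).
have dlS n : dl n.+1 <= dl n.
  apply: ler_wsqrtr; rewrite ler_wpM2l// lerD2r; apply: sg_le.
  by rewrite ltnS leq_double.
have dl_small c : 0 < c -> exists n, dl n < c.
  move=> c0; have [n hn] : exists n, C * (sg n.*2.+1 - slim) < c ^+ 2.
    have C1 : 0 < C + 1 by rewrite ltr_wpDl.
    have [_ [n _ <-] hn] : exists2 x, range (fun n => sg n.*2.+1) x &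
        x < slim + c ^+ 2 / (C + 1).
      by apply: inf_lt; rewrite ?ltrDl ?divr_gt0 ?exprn_gt0//; exists (sg 1), 0%N.
    exists n; apply: (@le_lt_trans _ _ ((C + 1) * (sg n.*2.+1 - slim))).
      by rewrite ler_wpM2r ?lerDl// subr_ge0.
    by rewrite mulrC -ltr_pdivlMr// ltrBlDl.
  exists n; rewrite -(ger0_norm (ltW c0)) -sqrtr_sqr.
  by rewrite ltr_sqrt// exprn_gt0.
pose N := [set p | forall n m, `|b n.+1 p - b (n + m).+1 p| <= dl n].
have aeN : {ae M, forall p, N p}.
  apply: ae_foralln => n; apply: ae_foralln => m.
  have bD : bounded_measurable (fun p => b n p - b (n + m)%N p) by exact: bmeasB.
  have := kmul_bound ms s_nu mskew erg iA2 (invariantB (ib n) (ib (n + m)%N)).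
  apply: filterS => p; rewrite kmulBr// !b_rec => h.
  rewrite -sqrtr_sqr; apply: ler_wsqrtr.
  have -> : (b n.+1 p - b (n + m).+1 p) ^+ 2 =
            l ^- 2 * (l * b n.+1 p - l * b (n + m).+1 p) ^+ 2.
    by field.
  rewrite /C -mulrA ler_pM2l ?invr_gt0 ?exprn_gt0//; apply: le_trans h _.
  rewrite ler_wpM2l ?inner_ge0//.
  rewrite innerBl// ![inner _ _ _ (fun p => b n p - _)]innerC !innerBl//.
  have := inner_b n 0; rewrite addn0 addnn => ->.
  have := inner_b (n + m)%N 0; rewrite addn0 addnn => ->.
  rewrite (innerC _ _ (b (n + m)%N)) inner_b.
  have h1 : sg (n + m).*2.+1 <= sg (n + (n + m)).+1.
    by apply: sg_le; rewrite ltnS -addnn leq_add2r leq_addr.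
  by have := slim_le (n + m)%N; lra.
have mN : measurable N.
  rewrite (_ : N = \bigcap_n \bigcap_m [set p | `|b n.+1 p - b (n + m).+1 p| <= dl n]).
    apply: bigcapT_measurable => n; apply: bigcapT_measurable => m.
    apply: measurable_lefun; last exact: measurable_cst.
    apply: measurableT_comp => //; apply: measurable_funB; exact: (bb _).1.
  apply/seteqP; split => p; first by move=> h n _ m _; exact: h.
  by move=> h n m; exact: h.
(* Cut off outside [N], the sequence converges at every point, so its limit is measurable. *)
pose u n p : R := \1_N p * b n.+1 p.
have u_cvg p : cvgn (u ^~ p).
  rewrite /u; have [Np|nNp] := pselect (N p); last first.
    rewrite (_ : (fun n => _) = fun=> 0); first exact: is_cvg_cst.
    by apply/funext => n; rewrite indicE memNset// mul0r.
  rewrite (_ : (fun n => _) = fun n => b n.+1 p); last first.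
    by apply/funext => n; rewrite indicE mem_set// mul1r.
  apply/cauchy_cvgP/cauchy_exP => c c0; have [k hk] := dl_small c c0.
  exists (b k.+1 p); exists k => // n /= kn.
  by rewrite /ball/= -(subnKC kn); exact: le_lt_trans (Np k _) hk.
pose P p := limn (u ^~ p).
have P0 p : ~ N p -> P p = 0.
  move=> nNp; rewrite /P (_ : u ^~ p = fun=> 0); first exact: lim_cst.
  by apply/funext => n; rewrite /u indicE memNset// mul0r.
have Pb p n : N p -> `|P p - b n.+1 p| <= dl n.
  move=> Np; have uE k : u k p = b k.+1 p by rewrite /u indicE mem_set// mul1r.
  have near_n : \forall k \near \oo, `|b n.+1 p - u k p| <= dl n.
    by exists n => // k /= nk; rewrite uE -(subnKC nk); exact: Np.
  rewrite ler_distl /P; apply/andP; split.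
    by apply: limr_ge => //; apply: filterS near_n => k; rewrite ler_distlC => /andP[].
  by apply: limr_le => //; apply: filterS near_n => k; rewrite ler_distlC => /andP[].
have bP : bounded_measurable P.
  split.
    apply: (measurable_fun_cvg (h := u)) => [n|p _]; last exact: u_cvg.
    by apply: measurable_funM; [exact: measurable_indic|exact: (bb _).1].
  have [_ [B b1B]] := bb 1%N; exists (B + dl 0%N) => p.
  have [Np|nNp] := pselect (N p); last first.
    by rewrite P0// normr0 addr_ge0 ?sqrtr_ge0// (le_trans _ (b1B p)).
  rewrite -(subrK (b 1%N p) (P p)) addrC (le_trans (ler_normD _ _))// lerD//.
  exact: Pb.
exists P; split.
- apply: (invariant_of_ae bP).
  have : {ae M, forall p, forall n, b n (square p) = b n p}.
    by apply: ae_foralln => n; exact: (invariant_ae mskew (ib n)).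
  apply: filterS => p hp; rewrite /P (_ : u ^~ (square p) = u ^~ p)//.
  have NN : N (square p) <-> N p by split => h n m; have := h n m; rewrite !hp.
  apply/funext => n; rewrite /u hp !indicE; congr ((nat_of_bool _)%:R * _).
  by apply/idP/idP; rewrite !in_setE => /NN.
- have [_ [B A2B]] := bA2.
  have B0 : 0 <= B by rewrite (le_trans _ (A2B point)).
  have h n : {ae M, forall p, `|(A2 ** P) p - l * P p| <= (B + l) * dl n}.
    have bA2P := bmeas_kmul mu nu bA2 bP.
    apply/(ae_fibers mu nu (P := fun p => `|(A2 ** P) p - l * P p| <= (B + l) * dl n)).
      apply: measurable_lefun; last exact: measurable_cst.
      apply: measurableT_comp => //; apply: measurable_funB; first exact: bA2P.1.
      exact: (bmeasZ l bP).1.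
    apply: filterS (ae_fibersW aeN) => x hx.
    have := (ae_fibers_swap nu x mN).1 hx => hx'.
    apply: filterS hx => y hy; apply: filterS2 hy hx' => y' Np Nz.
    set p := (x, y, y').
    (* As [A2 ** b n.+1] is [l * b n.+2], the defect of [P] splits into two errors, of size at most
       [B * dl n] and [l * dl n.+1]. *)
    have -> : (A2 ** P) p - l * P p =
      (A2 ** (fun q => P q - b n.+1 q)) p - l * (P p - b n.+2 p).
      by rewrite kmulBr// b_rec; ring.
    rewrite (le_trans (ler_normB _ _))// mulrDl lerD//; last first.
      rewrite normrM gtr0_norm// ler_pM2l// (le_trans _ (dlS n))//; exact: Pb.
    have bD : bounded_measurable (fun q => P q - b n.+1 q) by exact: bmeasB.
    apply: ler_norm_Rint_ae; first exact: (bmeas_integrand p bA2 bD).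
    apply: filterS Nz => z Nz; rewrite normrM ler_pM//; exact: Pb.
  have : {ae M, forall p, forall n, `|(A2 ** P) p - l * P p| <= (B + l) * dl n}.
    exact: ae_foralln.
  apply: filterS => p hp; apply/eqP; rewrite -subr_eq0 -normr_eq0.
  rewrite eq_le normr_ge0 andbT; apply/ler_addgt0Pr => c c0; rewrite add0r.
  have Bl : 0 < B + l by rewrite ltr_wpDl.
  have [n hn] := dl_small (c / (B + l)) (divr_gt0 c0 Bl).
  by apply: le_trans (hp n) _; rewrite mulrC -ler_pdivlMr// ltW.
(* If [P] vanished, [b n.+1] would be bounded by [dl n < 1] almost everywhere, whereas its squared
   norm is a value of [sg], hence at least 1. *)
- move=> P_eq0; have [n hn] := dl_small 1 ltr01.
  have := sg1 (n.+1 + n.+1).+1; have := inner_b n.+1 0; rewrite addn0 => <-.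
  apply/negP; rewrite -ltNge; apply: (@le_lt_trans _ _ (dl n ^+ 2)).
    rewrite -(Rint_cst M (dl n ^+ 2)); apply: le_Rint_ae.
    + exact: bmeasM.
    + exact: bmeas_cst.
    + apply: filterS2 aeN P_eq0 => p Np Pp0; rewrite -expr2 -real_normK ?num_real//.
      have := Pb p n Np; rewrite Pp0 sub0r normrN => h.
      by rewrite ler_sqr ?nnegrE// sqrtr_ge0.
  by rewrite expr_lt1// sqrtr_ge0.
Qed.

End eigenkernel.

(** The family may be infinite, so the argument is by minimality: let [V] be a nonzero subspace of
    least dimension stable under all matrices. An eigenspace of [a i] inside [V] is stable, by
    commutation, hence is all of [V]. Every matrix is thus scalar on [V], and any nonzero row of [V]
    will do. *)
Lemma common_eigenvector_family (C : numClosedFieldType) n (I : Type)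
    (a : I -> 'M[C]_n) : (0 < n)%N ->
  (forall i j, a i *m a j = a j *m a i) ->
  exists2 v : 'rV_n, v != 0 & forall i, exists c, v *m a i = c *: v.
Proof.
move=> n0 comm_a.
pose stable k := `[< exists V : 'M[C]_n,
  [/\ \rank V = k, (0 < k)%N & forall i, stablemx V (a i)] >].
have : exists k, stable k.
  by exists n; apply/asboolP; exists 1%:M; split; rewrite ?mxrank1// => i;
    exact: stableCmx.
move=> /ex_minnP[k /asboolP[V [rV k0 sV]] kmin].
have eigen i : exists c, (V <= eigenspace (a i) c)%MS.
  have rV0 : (0 < \rank V)%N by rewrite rV.
  have [c /eigenvalueP[w wc w0]] :=
    eigenvalue_closed (conjmx (row_base V) (a i)) rV0.
  have /eigenspaceP wE := wc.
  have sV' : stablemx (row_base V) (a i) by rewrite stablemx_row_base.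
  rewrite (sub_eigenspace_conjmx _ _ sV' (row_base_free V)) in wE.
  exists c; pose W := (V :&: eigenspace (a i) c)%MS.
  have wW : (w *m row_base V <= W)%MS.
    by rewrite sub_capmx wE andbT (submx_trans (submxMl _ _))// eq_row_base.
  have W0 : (0 < \rank W)%N.
    rewrite lt0n mxrank_eq0; apply: contraNneq w0 => W0.
    move: wW; rewrite W0 submx0 => h.
    by rewrite -(mulmx_free_eq0 w (row_base_free V)).
  have sW j : stablemx W (a j).
    rewrite sub_capmx (submx_trans (submxMr _ (capmxSl _ _)) (sV j))/=.
    apply: submx_trans (submxMr _ (capmxSr _ _)) _.
    by apply: comm_mx_stable_eigenspace; exact: comm_a.
  have kW : (k <= \rank W)%N by apply: kmin; apply/asboolP; exists W.
  have := mxrank_leqif_sup (capmxSl V (eigenspace (a i) c)).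
  case=> le eq; suff : (V <= W)%MS by move/submx_trans; apply; exact: capmxSr.
  by rewrite -eq eqn_leq le rV kW.
exists (nz_row V).
  by rewrite nz_row_eq0 -mxrank_eq0 rV -lt0n.
move=> i; have [c Vc] := eigen i; exists c; apply/eigenspaceP.
exact: submx_trans (nz_row_sub V) Vc.
Qed.

(** * Finite dimension of the eigenspaces *)

Section eigenspace.
Context {R : realType} {dX} {X : measurableType dX} {dY} {Y : measurableType dY}.
Variables (mu : probability X R) (nu : probability Y R).
Variables (T : X -> X) (s : X -> Y -> Y).
Hypotheses (ms : forall x, measurable_fun [set: Y] (s x))
  (s_nu : forall x A, measurable A -> nu (s x @^-1` A) = nu A).
Hypothesis mskew : measurable_fun [set: X * Y] (fun p => (T p.1, s p.1 p.2)).
Hypothesis erg : ergodic (mu \x nu)%E (fun p => (T p.1, s p.1 p.2)).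
Local Notation M := ((mu \x nu) \x nu)%E.
Local Notation invariant := (invariant_kernel mu nu T s).
Local Notation "<< K , L >>" := (inner mu nu K L).
Local Notation "K ** L" := (kmul nu K L) (at level 40, left associativity).
Implicit Types (K L : X * Y * Y -> R).

Variables (Q : X * Y * Y -> R) (l : R).
Hypotheses (iQ : invariant Q) (l0 : 0 < l).

Let bQ : bounded_measurable Q := iQ.1.

Definition eigenkernel K : Prop :=
  invariant K /\ {ae M, forall p, (Q ** K) p = l * K p}.

Lemma eigenkernel_bmeas K : eigenkernel K -> bounded_measurable K.
Proof. by move=> [[]]. Qed.

Lemma eigenkernelZ c K : eigenkernel K -> eigenkernel (fun p => c * K p).
Proof.
move=> [iK eK]; split; first exact: invariantZ.
by rewrite kmulZr//; [apply: filterS eK => p -> ; ring | exact: iK.1].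
Qed.

Lemma eigenkernelB K L : eigenkernel K -> eigenkernel L ->
  eigenkernel (fun p => K p - L p).
Proof.
move=> [iK eK] [iL eL]; split; first exact: invariantB.
rewrite kmulBr//; [|exact: iK.1|exact: iL.1].
by apply: filterS2 eK eL => p -> ->; ring.
Qed.

Lemma eigenkernel_sum n (K : 'I_n -> X * Y * Y -> R) :
  (forall i, eigenkernel (K i)) -> eigenkernel (fun p => \sum_i K i p).
Proof.
move=> eK; split; first by apply: invariant_sum => i; exact: (eK i).1.
rewrite kmul_sumr//; last by move=> i; exact: eigenkernel_bmeas.
have : {ae M, forall p, forall i, (Q ** K i) p = l * K i p}.
  by apply: filter_forall => i; exact: (eK i).2.
by apply: filterS => p h; rewrite mulr_sumr; apply: eq_bigr => i _; rewrite h.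
Qed.

Definition orthonormal_eigenkernels n (K : 'I_n -> X * Y * Y -> R) : Prop :=
  (forall i, eigenkernel (K i)) /\ forall i j, <<K i, K j>> = (i == j)%:R.

Lemma bessel n (k : 'I_n -> Y -> R) (q : Y -> R) :
  (forall i, bounded_measurable (k i)) -> bounded_measurable q ->
  (forall i j, \int[nu]_y (k i y * k j y) = (i == j)%:R) ->
  \sum_i (\int[nu]_y (q y * k i y)) ^+ 2 <= \int[nu]_y (q y ^+ 2).
Proof.
move=> bk bq ok; pose c i := \int[nu]_y (q y * k i y).
pose h y := \sum_i c i * k i y.
have bck i : bounded_measurable (fun y => c i * k i y) by exact: bmeasZ.
have bh : bounded_measurable h by exact: bmeas_sum.
have qh : \int[nu]_y (q y * h y) = \sum_i c i ^+ 2.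
  under eq_Rintegral do rewrite mulr_sumr.
  rewrite Rint_sum; last by move=> i; exact: bmeasM.
  apply: eq_bigr => i _; rewrite expr2 -RintZl; last exact: bmeasM.
  by apply: eq_Rintegral => y _; ring.
have kh i : \int[nu]_y (k i y * h y) = c i.
  under eq_Rintegral do rewrite mulr_sumr.
  rewrite Rint_sum; last by move=> j; exact: bmeasM.
  rewrite (bigD1 i)//= big1 ?addr0.
    have := ok i i; rewrite eqxx => kii.
    rewrite -[RHS]mulr1 -[X in _ = _ * X]kii -RintZl; last exact: bmeasM.
    by apply: eq_Rintegral => y _; ring.
  move=> j ji; have := ok i j; rewrite eq_sym (negbTE ji) => kij.
  rewrite -[RHS](mulr0 (c j)) -[X in _ = _ * X]kij -RintZl; last exact: bmeasM.
  by apply: eq_Rintegral => y _; ring.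
have hh : \int[nu]_y (h y * h y) = \sum_i c i ^+ 2.
  under eq_Rintegral do rewrite {1}/h mulr_suml.
  rewrite Rint_sum; last by move=> i; exact: bmeasM.
  apply: eq_bigr => i _.
  have -> : c i ^+ 2 = c i * \int[nu]_y (k i y * h y) by rewrite kh expr2.
  rewrite -RintZl; last exact: bmeasM.
  by apply: eq_Rintegral => y _; ring.
have := Rint_sqr_ge0 nu (fun y => q y - h y).
have -> : \int[nu]_y ((q y - h y) ^+ 2) =
    \int[nu]_y (q y ^+ 2) - 2 * \int[nu]_y (q y * h y) + \int[nu]_y (h y * h y).
  have bqh : bounded_measurable (fun y => q y * h y) by exact: bmeasM.
  have bqq : bounded_measurable (fun y => q y ^+ 2) by exact: bmeasX.
  rewrite -RintZl// -RintB//; last exact: bmeasZ.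
  rewrite -RintD; [|by apply: bmeasB => //; exact: bmeasZ|exact: bmeasM].
  by apply: eq_Rintegral => y _; ring.
by rewrite qh hh -/(c _) mulr_natl mulr2n; lra.
Qed.

(** The products [K i * K j] are invariant, so orthonormality, an averaged statement, holds for the
    columns [K i (x, _, y')] in almost every fibre. The coefficients of the row [Q (x, y, _)] along
    these columns are the values [l * K i (x, y, y')]; Bessel's inequality bounds the sum of their
    squares by the constant row norm of [Q], and integration gives the claim. *)
Lemma orthonormal_card n (K : 'I_n -> X * Y * Y -> R) :
  orthonormal_eigenkernels K -> l ^+ 2 * n%:R <= <<Q, Q>>.
Proof.
move=> [eK oK]; have bK i := eigenkernel_bmeas (eK i).
have le_ae : {ae M, forall p, \sum_i (l * K i p) ^+ 2 <= <<Q, Q>>}.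
  have bs : bounded_measurable (fun p => \sum_i (l * K i p) ^+ 2).
    by apply: bmeas_sum => i; apply: bmeasX; exact: bmeasZ.
  apply/(ae_fibers mu nu (P := fun p => \sum_i (l * K i p) ^+ 2 <= <<Q, Q>>)).
    by apply: measurable_lefun; [exact: bs.1|exact: measurable_cst].
  have h1 : {ae mu, forall x, {ae nu, forall y', forall i j,
      \int[nu]_y (K i (x, y, y') * K j (x, y, y')) = (i == j)%:R}}.
    have : {ae mu, forall x, forall i j, {ae nu, forall y',
        \int[nu]_y (K i (x, y, y') * K j (x, y, y')) = (i == j)%:R}}.
      apply: filter_forall => i; apply: filter_forall => j; rewrite -oK.
      exact: (fiber_midP ms s_nu mskew erg (invariantM (eK i).1 (eK j).1)).
    apply: filterS => x h; apply: filter_forall => i; apply: filter_forall => j.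
    exact: h.
  have h2 := fiber_lastP ms s_nu mskew erg (invariantM iQ iQ).
  have h3 : {ae M, forall p, forall i, (Q ** K i) p = l * K i p}.
    by apply: filter_forall => i; exact: (eK i).2.
  apply: filterS3 h1 h2 (ae_fibersW h3) => x {}h1 {}h2 {}h3.
  apply: filterS2 h2 h3 => y {}h2; apply: filterS2 h1 => y' {}h1 {}h3.
  rewrite [leRHS](_ : _ = \int[nu]_z (Q (x, y, z) ^+ 2)); last exact: esym h2.
  under eq_bigr do rewrite -h3.
  apply: (@bessel n (fun i y => K i (x, y, y')) (fun z => Q (x, y, z))) => //.
  - by move=> i; exact: bmeas_mid.
  - exact: bmeas_pair1.
have := le_Rint_ae (m := M) _ (bmeas_cst <<Q, Q>>) le_ae.
rewrite Rint_cst Rint_sum.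
  move=> h; apply: le_trans (h _); last first.
    by apply: bmeas_sum => i; apply: bmeasX; exact: bmeasZ.
  rewrite (eq_bigr (fun=> l ^+ 2)); first by rewrite sumr_const card_ord mulr_natr.
  move=> i _; have := oK i i; rewrite eqxx => Kii.
  rewrite -[RHS]mulr1 -[X in _ = _ * X]Kii -RintZl; last exact: bmeasM.
  by apply: eq_Rintegral => p _; ring.
by move=> i; apply: bmeasX; exact: bmeasZ.
Qed.

(** Sizes of orthonormal families are bounded by [orthonormal_card]. For a family of maximal size
    the residual [D] of an eigenkernel has norm zero, as its normalization could otherwise be added,
    here at index [ord0]. *)
Lemma orthonormal_basis : exists n (K : 'I_n -> X * Y * Y -> R),
  orthonormal_eigenkernels K /\
  forall H, eigenkernel H -> {ae M, forall p, H p = \sum_i <<H, K i>> * K i p}.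
Proof.
pose card n := `[< exists K : 'I_n -> X * Y * Y -> R, orthonormal_eigenkernels K >].
have card0 : exists n, card n.
  exists 0%N; apply/asboolP; exists (fun i p => 0).
  by split => [[]|[]].
have card_le n : card n -> (n <= Num.truncn (<<Q, Q>> / l ^+ 2))%N.
  move=> /asboolP[K oK]; rewrite truncn_ge_nat; last first.
    by rewrite divr_ge0 ?inner_ge0// exprn_ge0// ltW.
  by rewrite ler_pdivlMr ?exprn_gt0// mulrC; exact: orthonormal_card oK.
case: (ex_maxnP card0 card_le) => n /asboolP[K oK] nmax.
exists n, K; split => // H eH; have [eK kK] := oK.
have bK i := eigenkernel_bmeas (eK i); have bH := eigenkernel_bmeas eH.
pose S p := \sum_i <<H, K i>> * K i p.
pose D p := H p - S p.
have eS : eigenkernel S.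
  by apply: eigenkernel_sum => i; exact: eigenkernelZ.
have bS := eigenkernel_bmeas eS.
have eD : eigenkernel D by exact: eigenkernelB.
have bD := eigenkernel_bmeas eD.
have DK j : <<D, K j>> = 0.
  rewrite innerBl// inner_suml//; last by move=> i; exact: bmeasZ.
  rewrite (bigD1 j)//= innerZl// kK eqxx mulr1 big1 ?addr0 ?subrr// => i ij.
  by rewrite innerZl// kK (negbTE ij) mulr0.
have [D0|D0] := eqVneq <<D, D>> 0.
  by apply: filterS (inner_eq0 bD D0) => p /subr0_eq.
have D_gt0 : 0 < <<D, D>> by rewrite lt_neqAle eq_sym D0 inner_ge0.
pose c := (Num.sqrt <<D, D>>)^-1.
pose K' (i : 'I_n.+1) := if unlift ord0 i is Some j then K j else fun p => c * D p.
suff oK' : orthonormal_eigenkernels K'.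
  have : card n.+1 by apply/asboolP; exists K'.
  by move/nmax; rewrite ltnn.
split=> [i|i j].
  by rewrite /K'; case: unliftP => [j _|_]; [exact: eK|exact: eigenkernelZ].
have cDK m : <<fun p => c * D p, K m>> = 0 by rewrite innerZl// DK mulr0.
rewrite /K'; case: (unliftP ord0 i) => [i' ->|->]; case: (unliftP ord0 j) => [j' ->|->].
- by rewrite kK (inj_eq lift_inj).
- by rewrite innerC cDK eq_sym (negbTE (neq_lift _ _)).
- by rewrite cDK (negbTE (neq_lift _ _)).
- have bcD : bounded_measurable (fun p => c * D p) by exact: bmeasZ.
  rewrite innerZl// innerC innerZl// eqxx mulrA -expr2 exprVn sqr_sqrtr ?ltW//.
  by rewrite mulVf.
Qed.

End eigenspace.

Section complex_parts.
Context {R : realType}.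
Implicit Types (z w : R[i]).

Lemma complex_ReM z w : complex.Re (z * w) =
  complex.Re z * complex.Re w - complex.Im z * complex.Im w.
Proof. by case: z w => [a b] [c d]. Qed.

Lemma complex_ImM z w : complex.Im (z * w) =
  complex.Re z * complex.Im w + complex.Im z * complex.Re w.
Proof. by case: z w => [a b] [c d]. Qed.

Lemma complex_Re_sum n (f : 'I_n -> R[i]) :
  complex.Re (\sum_i f i) = \sum_i complex.Re (f i).
Proof. by apply: (big_morph (@complex.Re R)) => // -[a b] [c d]. Qed.

Lemma complex_Im_sum n (f : 'I_n -> R[i]) :
  complex.Im (\sum_i f i) = \sum_i complex.Im (f i).
Proof. by apply: (big_morph (@complex.Im R)) => // -[a b] [c d]. Qed.

End complex_parts.

(** * Action on eigenkernels of the maps commuting with the fibre maps *)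

Section commuting_action.
Context {R : realType} {dX} {X : measurableType dX} {dY} {Y : measurableType dY}.
Variables (mu : probability X R) (nu : probability Y R).
Variables (T : X -> X) (s : X -> Y -> Y).
Hypotheses (ms : forall x, measurable_fun [set: Y] (s x))
  (s_nu : forall x A, measurable A -> nu (s x @^-1` A) = nu A).
Hypothesis mskew : measurable_fun [set: X * Y] (fun p => (T p.1, s p.1 p.2)).
Hypothesis erg : ergodic (mu \x nu)%E (fun p => (T p.1, s p.1 p.2)).
Local Notation M := ((mu \x nu) \x nu)%E.
Local Notation invariant := (invariant_kernel mu nu T s).
Local Notation "<< K , L >>" := (inner mu nu K L).
Local Notation "K ** L" := (kmul nu K L) (at level 40, left associativity).
Implicit Types (K L : X * Y * Y -> R).

Definition act (v : Y -> Y) K (p : X * Y * Y) : R := K (p.1, v p.2).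

Section one_map.
Variable v : Y -> Y.
Hypotheses (mv : measurable_fun [set: Y] v)
  (v_nu : forall A, measurable A -> nu (v @^-1` A) = nu A)
  (v_comm : forall x, {ae nu, forall y, v (s x y) = s x (v y)}).

Lemma measurable_act : measurable_fun [set: X * Y * Y]
  (fun p : X * Y * Y => (p.1, v p.2)).
Proof. by apply: measurable_fun_pair => //; exact: measurableT_comp. Qed.

Lemma act_bmeas K : bounded_measurable K -> bounded_measurable (act v K).
Proof. exact: bmeas_comp measurable_act. Qed.

Lemma act_ae (P : X * Y * Y -> Prop) : {ae M, forall p, P p} ->
  {ae M, forall p, P (p.1, v p.2)}.
Proof.
move=> [N [mN N0 PN]].
have aeN : {ae M, forall p, (~` N) p} by exists N; split => // p /contrapT.
suff : {ae M, forall p, (~` N) (p.1, v p.2)}.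
  by apply: filterS => p nN; apply: contrapT => nP; apply: nN; apply: PN.
apply/(ae_fibers mu nu (P := fun p => (~` N) (p.1, v p.2))).
  rewrite -[X in measurable X]setTI.
  exact: (measurable_act measurableT (measurableC mN)).
apply: filterS (ae_fibersW aeN) => x; apply: filterS => y h.
exact: (ae_preserving mv v_nu h).
Qed.

Lemma inner_act K L : bounded_measurable K -> bounded_measurable L ->
  <<act v K, act v L>> = <<K, L>>.
Proof.
move=> bK bL; have bKL := bmeasM bK bL.
rewrite /inner (Rint_prod1 (mu \x nu)%E nu bKL).
rewrite (Rint_prod1 (mu \x nu)%E nu (bmeasM (act_bmeas bK) (act_bmeas bL))).
apply: eq_Rintegral => z _.
exact: (Rint_preserving mv v_nu (bmeas_pair1 z bKL)).
Qed.

Lemma act_invariant K : invariant K -> invariant (act v K).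
Proof.
move=> [bK iK]; split; first exact: act_bmeas.
apply: filterS iK => x; apply: filterS => y h.
have := ae_preserving mv v_nu h; rewrite /act/=.
by apply: filterS2 (v_comm x) => y' ->.
Qed.

(** Left composition with [Q] leaves the last variable alone, so [Q ** act v K] and [act v (Q ** K)]
    are convertible. This is why the action is on the last variable. *)
Lemma act_eigenkernel (Q : X * Y * Y -> R) l K :
  eigenkernel mu nu T s Q l K -> eigenkernel mu nu T s Q l (act v K).
Proof. by move=> [iK eK]; split; [exact: act_invariant|exact: act_ae eK]. Qed.

End one_map.

Variables (I : Type) (v : I -> Y -> Y).
Hypotheses (mv : forall i, measurable_fun [set: Y] (v i))
  (v_nu : forall i A, measurable A -> nu (v i @^-1` A) = nu A)
  (v_comm : forall i x, {ae nu, forall y, v i (s x y) = s x (v i y)})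
  (vv : forall i j, {ae nu, forall y, v i (v j y) = v j (v i y)}).
Variables (Q : X * Y * Y -> R) (l : R).
Hypotheses (iQ : invariant Q) (l0 : 0 < l).
Local Notation eigen := (eigenkernel mu nu T s Q l).

(** In an orthonormal basis of the eigenspace the maps act by commuting real matrices, whose common
    eigenvector [w] exists over the complex numbers only. The pair [H1], [H2] consists of the real
    and imaginary parts of the kernel with coordinates [w], and [a + i b] is its eigenvalue. The
    kernel [P] serves to make the eigenspace nonzero. *)
Lemma common_eigenpair P : eigen P -> ~ {ae M, forall p, P p = 0} ->
  exists H1 H2, [/\ eigen H1, eigen H2, 0 < <<H1, H1>> + <<H2, H2>> &
    forall i, exists a b, {ae M, forall p,
      act (v i) H1 p = a * H1 p - b * H2 p /\
      act (v i) H2 p = a * H2 p + b * H1 p}].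
Proof.
move=> eP nP.
have [n [K [[eK oK] basis]]] := orthonormal_basis ms s_nu mskew erg iQ l0.
have bK i := eigenkernel_bmeas (eK i).
have n0 : (0 < n)%N.
  case: n K eK oK basis {bK} => // K _ _ /(_ _ eP) h; exfalso; apply: nP.
  by apply: filterS h => p ->; rewrite big_ord0.
pose a i : 'M[R]_n := \matrix_(r, c) <<act (v i) (K r), K c>>.
have actK i r : {ae M, forall p, act (v i) (K r) p = \sum_c a i r c * K c p}.
  have := basis _ (act_eigenkernel (mv i) (v_nu i) (v_comm i) (eK r)).
  by apply: filterS => p ->; apply: eq_bigr => c _; rewrite mxE.
have bact i L : bounded_measurable L -> bounded_measurable (act (v i) L).
  exact: act_bmeas.
(* Coordinates are rows, so composition corresponds to the matrix product in reverse order. *)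
have aM i j r c : <<act (v i) (act (v j) (K r)), K c>> = (a j *m a i) r c.
  rewrite mxE.
  transitivity (\sum_k <<fun p => a j r k * act (v i) (K k) p, K c>>); last first.
    by apply: eq_bigr => k _; rewrite [a i _ _]mxE innerZl//; exact: bact.
  rewrite -inner_suml//; last by move=> k; apply: bmeasZ; exact: bact.
  apply: inner_ae => //.
  - exact/bact/bact.
  - by apply: bmeas_sum => k; apply: bmeasZ; exact: bact.
  - by have := act_ae (mv i) (v_nu i) (actK j r).
  - exact: aeW.
have a_comm i j : a i *m a j = a j *m a i.
  apply/matrixP => r c; rewrite -!aM; apply: inner_ae => //.
  - exact/bact/bact.
  - exact/bact/bact.
  - apply: (ae_fibers mu nu _).2.
      by apply: measurable_eqfun; exact: (bact _ _ (bact _ _ (bK r))).1.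
    apply: aeW => x; apply: aeW => y; apply: filterS (vv i j) => y' e.
    by rewrite /act/= e.
  - exact: aeW.
have [w w0 wE] := common_eigenvector_family n0
    (a := fun i => map_mx (real_complex R) (a i))
    (fun i j => ltac:(by rewrite -!map_mxM a_comm)).
pose H1 p := \sum_r complex.Re (w 0 r) * K r p.
pose H2 p := \sum_r complex.Im (w 0 r) * K r p.
have bZ (f : 'I_n -> R) r : bounded_measurable (fun p => f r * K r p).
  exact: bmeasZ.
have innerH (f : 'I_n -> R) :
    <<fun p => \sum_r f r * K r p, fun p => \sum_r f r * K r p>> = \sum_r f r ^+ 2.
  rewrite inner_suml//; last by apply: bmeas_sum => r; exact: bZ.
  apply: eq_bigr => r _; rewrite innerZl//; last by apply: bmeas_sum => c; exact: bZ.
  rewrite innerC inner_suml// (bigD1 r)//= innerZl// oK eqxx mulr1 big1 ?addr0//.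
  by move=> c cr; rewrite innerZl// oK (negbTE cr) mulr0.
exists H1, H2; split.
- by apply: (eigenkernel_sum iQ) => r; exact: (eigenkernelZ iQ).
- by apply: (eigenkernel_sum iQ) => r; exact: (eigenkernelZ iQ).
- rewrite !innerH -big_split/=.
  have /rV0Pn[r wr] := w0.
  rewrite (bigD1 r)//= ltr_wpDr//.
    by apply: sumr_ge0 => c _; rewrite addr_ge0 ?sqr_ge0.
  rewrite lt_neqAle addr_ge0 ?sqr_ge0// andbT eq_sym paddr_eq0 ?sqr_ge0//.
  rewrite !sqrf_eq0; apply: contraNN wr.
  by rewrite eq_complex.
- move=> i; have [c cE] := wE i; exists (complex.Re c), (complex.Im c).
  have wc k : c * w 0 k = \sum_r w 0 r * ((a i r k)%:C)%C.
    have /rowP/(_ k) := cE; rewrite !mxE => <-.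
    by apply: eq_bigr => r _; rewrite mxE.
  have re k : \sum_r complex.Re (w 0 r) * a i r k =
      complex.Re c * complex.Re (w 0 k) - complex.Im c * complex.Im (w 0 k).
    rewrite -complex_ReM wc complex_Re_sum; apply: eq_bigr => r _.
    by rewrite complex_ReM/= mulr0 subr0.
  have im k : \sum_r complex.Im (w 0 r) * a i r k =
      complex.Re c * complex.Im (w 0 k) + complex.Im c * complex.Re (w 0 k).
    rewrite -complex_ImM wc complex_Im_sum; apply: eq_bigr => r _.
    by rewrite complex_ImM/= mulr0 add0r.
  have : {ae M, forall p, forall r, act (v i) (K r) p = \sum_k a i r k * K k p}.
    by apply: filter_forall => r; exact: actK.
  apply: filterS => p hp.
  have expand (f : 'I_n -> R) : act (v i) (fun p => \sum_r f r * K r p) p =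
      \sum_k (\sum_r f r * a i r k) * K k p.
    rewrite {1}/act/=.
    under eq_bigr => r _ do rewrite -[K r _]/(act (v i) (K r) p) hp mulr_sumr.
    rewrite exchange_big/=; apply: eq_bigr => k _; rewrite mulr_suml.
    by apply: eq_bigr => r _; rewrite mulrA.
  split.
    rewrite expand /H1 /H2 !mulr_sumr -sumrB; apply: eq_bigr => k _.
    by rewrite re; ring.
  rewrite expand /H1 /H2 !mulr_sumr -big_split/=; apply: eq_bigr => k _.
  by rewrite im; ring.
Qed.

End commuting_action.

(** * Measurable characters are continuous *)

Section baire_category.
Context {T : topologicalType}.
Implicit Types (A U V : set T).

Definition nowhere_dense_closed (F : set T) : Prop :=
  closed F /\ forall U, open U -> U !=set0 -> ~ U `<=` F.

Definition meager A : Prop := exists F : nat -> set T,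
  (forall n, nowhere_dense_closed (F n)) /\ A `<=` \bigcup_n F n.

(** The Baire property. *)
Definition almost_open A : Prop :=
  exists U, open U /\ meager ((A `\` U) `|` (U `\` A)).

Lemma nowhere_dense_closed0 : nowhere_dense_closed set0.
Proof. by split; [exact: closed0|move=> U _ [x Ux] /(_ x Ux)]. Qed.

Lemma meagerS A B : A `<=` B -> meager B -> meager A.
Proof. by move=> AB [F [ndF BF]]; exists F; split => //; exact: subset_trans BF. Qed.

Lemma meager_bigcup (A : nat -> set T) : (forall n, meager (A n)) ->
  meager (\bigcup_n A n).
Proof.
move=> mA; have [F FP] := choice mA.
exists (fun k => if unpickle k is Some nm then F nm.1 nm.2 else set0); split.
  move=> k; case: unpickle => [[n m]|]; [exact: (FP n).1|exact: nowhere_dense_closed0].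
move=> x [n _ Anx]; have [m _ Fx] := (FP n).2 x Anx.
by exists (pickle (n, m)) => //; rewrite pickleK.
Qed.

Lemma meagerU A B : meager A -> meager B -> meager (A `|` B).
Proof.
move=> mA mB; rewrite -bigcup2E; apply: meager_bigcup => -[|[|n]] //=.
by exists (fun=> set0); split => // n'; exact: nowhere_dense_closed0.
Qed.

Lemma nowhere_dense_meager F : nowhere_dense_closed F -> meager F.
Proof. by move=> ndF; exists (fun=> F); split => // x Fx; exists 0%N. Qed.

(** For complements, the witness [U] is replaced by the complement of its closure; the discrepancy
    is the boundary of [U], which is closed and nowhere dense. *)
Lemma almost_open_sigma_algebra : sigma_algebra setT almost_open.
Proof.
split.
- exists set0; split; first exact: open0.
  by rewrite setDv setUid; apply: nowhere_dense_meager; exact: nowhere_dense_closed0.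
- move=> A [U [oU mU]]; exists (~` closure U); split.
    by rewrite openC; exact: closed_closure.
  have mbd : meager (closure U `\` U).
    apply: nowhere_dense_meager; split.
      by apply: closedI; [exact: closed_closure|rewrite closedC].
    move=> V oV [x Vx] VU.
    have [xU _] := VU x Vx.
    have [y [Uy Vy]] := xU V (open_nbhs_nbhs (conj oV Vx)).
    by have [_] := VU y Vy; apply.
  apply: meagerS (meagerU mU mbd) => x /=.
  move=> [[[_ nAx] /contrapT cUx]|[ncUx /not_andP[//|/contrapT Ax]]].
    by have [Ux|nUx] := pselect (U x); [left; right|right].
  by left; left; split => // Ux; apply: ncUx; exact: subset_closure.
- move=> A aoA; have [U UP] := choice aoA.
  exists (\bigcup_n U n); split; first by apply: bigcup_open => n _; exact: (UP n).1.
  apply: meagerS (meager_bigcup (fun n => (UP n).2)) => x [[[n _ Ax] nU]|[[n _ Ux] nA]].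
    by exists n => //; left; split => // Ux; apply: nU; exists n.
  by exists n => //; right; split => // Ax; apply: nA; exists n.
Qed.

Lemma open_almost_open U : open U -> almost_open U.
Proof.
move=> oU; exists U; split => //; rewrite setDv setUid.
by apply: nowhere_dense_meager; exact: nowhere_dense_closed0.
Qed.

Lemma borel_almost_open A : <<s @open T >> A -> almost_open A.
Proof.
apply: smallest_sub; first exact: almost_open_sigma_algebra.
exact: open_almost_open.
Qed.

Hypotheses (hT : hausdorff_space T) (lcT : locally_compact [set: T]).

Lemma open_shrink U x : open U -> U x ->
  exists V, [/\ open V, V x, closure V `<=` U & compact (closure V)].
Proof.
move=> oU Ux; have := @lcT x I; rewrite withinET => -[B Bx [cB clB]].
have xB : nbhs x B by exact: Bx.
have [C Cx CU] := compact_regular hT cB xB (open_nbhs_nbhs (conj oU Ux)).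
exists (C° `&` B°); split.
- by apply: openI; exact: open_interior.
- by [].
- apply: subset_trans CU; apply: closureS => y [+ _]; exact: interior_subset.
- apply: (subclosed_compact _ cB); first exact: closed_closure.
  rewrite [X in _ `<=` X](closure_id _).1//; apply: closureS => y [_].
  exact: interior_subset.
Qed.

(** Baire's theorem for locally compact Hausdorff spaces: nonempty open sets are nested so that the
    closure of each avoids one more [F n]. Since the first closure is compact, points chosen in
    these sets have a cluster point, which lies in every closure and so in no [F n]. *)
Lemma open_not_meager U : open U -> U !=set0 -> ~ meager U.
Proof.
move=> oU [x0 Ux0] [F [ndF UF]].
have [V0 [oV0 V0x0 V0U cV0]] := open_shrink oU Ux0.
pose S := (nat * {V : set T | open V /\ V !=set0})%type.
pose rel (a b : S) := b.1 = a.1.+1 /\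
  closure (sval b.2) `<=` sval a.2 `\` F a.1.
have step (a : S) : {b : S | rel a b}.
  apply: cid; case: a => n [V [oV V_neq0]].
  have [clF ndFn] := ndF n.
  have oVF : open (V `\` F n) by apply: openI => //; rewrite openC.
  have [y VFy] : (V `\` F n) !=set0.
    apply: contrapT => VF; apply: (ndFn V oV V_neq0) => z Vz.
    by apply: contrapT => nFz; apply: VF; exists z.
  have [W [oW Wy WVF _]] := open_shrink oVF VFy.
  by exists (n.+1, exist _ W (conj oW (ex_intro _ y Wy))).
have [f [f0 fS]] := dependent_choice step
  (0%N, exist _ V0 (conj oV0 (ex_intro _ x0 V0x0))).
have f1 n : (f n).1 = n.
  by elim: n => [|n IH]; [rewrite f0|rewrite (fS n).1 IH].
pose V n := sval (f n).2.
have VS n : closure (V n.+1) `<=` V n `\` F n.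
  by have := (fS n).2; rewrite f1.
have Vmono n m : (n <= m)%N -> V m `<=` V n.
  elim: m => [|m IH]; first by rewrite leqn0 => /eqP->.
  rewrite leq_eqVlt ltnS => /predU1P[->//|/IH]; apply: subset_trans => z Vz.
  by have [] := VS m z (subset_closure Vz).
have [u uP] := choice (fun n => (svalP (f n).2).2).
have u_in n : \forall k \near \oo, V n (u k).
  by exists n => // k /= nk; apply: (Vmono n k nk); exact: uP.
have cluster_u : closure (V 0%N) `&` cluster (u @ \oo) !=set0.
  apply: (_ : compact (closure (V 0%N))); first by rewrite /V f0.
  by apply: filterS (u_in 0%N) => k; exact: subset_closure.
have [p [_ pu]] := cluster_u.
have pV n : closure (V n) p by move=> B Bp; exact: pu (u_in n) Bp.
have pU : U p by apply: V0U; have := pV 0%N; rewrite /V f0.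
have [n _ Fp] := UF p pU.
by have [_] := VS n p (pV n.+1).
Qed.

End baire_category.

Section measurable_characters.
Context {R : realType} {G : topologicalZmodType}.
Hypothesis lcscG : lcsc_group G.

Lemma translate_continuous (h : G) : continuous (fun g : G => g - h).
Proof.
move=> g; apply: (@continuous_comp _ _ _ (fun g : G => (g, h)) (fun z => z.1 - z.2)).
  by apply: cvg_pair => //=; exact: cvg_cst.
exact: sub_continuous.
Qed.

Lemma translater_continuous (h : G) : continuous (fun g : G => h + g).
Proof.
move=> g; apply: (@continuous_comp _ _ _ (fun g : G => (h, g)) (fun z => z.1 + z.2)).
  by apply: cvg_pair => //=; exact: cvg_cst.
exact: add_continuous.
Qed.

Lemma meager_translate (A : set G) h : meager A -> meager [set g | A (g - h)].
Proof.
move=> [F [ndF AF]]; exists (fun n => [set g | F n (g - h)]); split; last first.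
  by move=> g /AF[n _ Fn]; exists n.
move=> n; have [clF ndFn] := ndF n; split.
  by apply: preimage_closed clF => g _; exact: translate_continuous.
move=> U oU [x Ux] UF; apply: (ndFn [set g | U (h + g)]).
- by apply: open_comp oU => g _; exact: translater_continuous.
- by exists (x - h); rewrite /= subrKC.
- by move=> g /UF /=; rewrite addrAC subrr add0r.
Qed.

(* Pettis' argument: among countably many Borel sets covering G one is not
   meager, and the differences of its elements fill a neighbourhood of 0. *)
Lemma pettis (A : nat -> set G) : (forall n, <<s @open G >> (A n)) ->
  (forall g, exists n, A n g) ->
  exists n, \forall h \near (0 : G), exists g, A n g /\ A n (g - h).
Proof.
move=> bA covA; have [hdG lcG _] := lcscG.
have [n nmA] : exists n, ~ meager (A n).
  apply: contrapT => /forallNP mA.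
  apply: (open_not_meager hdG lcG openT); first by exists 0.
  apply: meagerS (meager_bigcup (fun n => contrapT (mA n))) => g _.
  by have [n An] := covA g; exists n.
exists n; have [U [oU mU]] := borel_almost_open (bA n).
have [u0 Uu0] : U !=set0.
  apply: contrapT => U0; apply: nmA; apply: meagerS mU => g Ag.
  by left; split => // Ug; apply: U0; exists g.
have nbhs0 : \forall h \near (0 : G), U (u0 + h).
  have := @translater_continuous u0 0; rewrite /continuous_at addr0; apply.
  exact: open_nbhs_nbhs.
apply: filterS nbhs0 => h Uh.
(* This open set contains [u0 + h]. If no [g] were suitable, each of its points would lie in [U]
   minus [A n] or in the translate of that set by [h], and [V] would be meager. *)
pose V := [set g | U g /\ U (g - h)].
have oV : open V.
  by apply: openI => //; apply: open_comp oU => g _; exact: translate_continuous.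
apply: contrapT => /forallNP none; apply: (open_not_meager hdG lcG oV).
  by exists (u0 + h); split => //=; rewrite addrK.
apply: meagerS (meagerU mU (meager_translate h mU)) => g [Ug Ugh].
have [Ag|nAg] := pselect (A n g); last by left; right.
right; right; split => // Agh; exact: (none g).
Qed.

(** By multiplicativity, continuity at 0 is enough. The plane is cut into countably many squares of
    side [e / 2], and [pettis] gives one for which all [h] near 0 are of the form [g - (g - h)] with
    [chi g] and [chi (g - h)] in that square. Then [chi h] is as far from 1 as these two values are
    from each other, which is less than [e]. *)
Lemma measurable_character_continuous (chi : G -> R[i]) :
  measurable_fun [set: borel G] ((fun g => complex.Re (chi g)) : borel G -> R) ->
  measurable_fun [set: borel G] ((fun g => complex.Im (chi g)) : borel G -> R) ->
  (forall g h, chi (g + h) = chi g * chi h) -> (forall g, `|chi g| = 1) ->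
  continuous (chi : G -> R[i]^o).
Proof.
move=> mre mim chiM chi1.
suff near0 (e : R) : 0 < e ->
    \forall h \near (0 : G),
      (complex.Re (chi h) - 1) ^+ 2 + complex.Im (chi h) ^+ 2 < e ^+ 2.
  move=> g; apply/cvgrPdist_lt => -[e e'] /=.
  (* The radius is an element of [R[i]]; being positive, it is real. *)
  rewrite ltcE/= => /andP[/eqP -> {e'} e0].
  have := @translate_continuous g g; rewrite /continuous_at subrr.
  move=> /(_ _ (near0 e e0)); rewrite nbhs_filterE/=.
  apply: filterS => h /= hlt.
  have -> : chi g - chi h = - (chi g * (chi (h - g) - 1)).
    by rewrite mulrBr mulr1 -chiM subrKC opprB.
  rewrite normrN normrM chi1 mul1r normc_def ltcE/= eqxx/=.
  rewrite -[ltRHS](ger0_norm (ltW e0)) -sqrtr_sqr ltr_sqrt ?exprn_gt0//.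
  by move: hlt; case: (chi (h - g)) => a b /=; rewrite oppr0 addr0.
move=> e0; pose d := e / 2; have d0 : 0 < d by rewrite divr_gt0.
pose cell (ab : int * int) : set G := [set g |
  `[ab.1%:~R * d, (ab.1 + 1)%:~R * d[%classic (complex.Re (chi g)) /\
  `[ab.2%:~R * d, (ab.2 + 1)%:~R * d[%classic (complex.Im (chi g))].
pose A k := if unpickle k is Some ab then cell ab else set0.
have bA k : <<s @open G >> (A k).
  rewrite /A; case: unpickle => [ab|]; last exact: (@measurable0 _ (borel G)).
  have m1 := mre measurableT _ (measurable_itv `[ab.1%:~R * d, (ab.1 + 1)%:~R * d[).
  have m2 := mim measurableT _ (measurable_itv `[ab.2%:~R * d, (ab.2 + 1)%:~R * d[).
  by have := measurableI _ _ m1 m2; rewrite !setTI.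
have covA g : exists k, A k g.
  exists (pickle (Num.floor (complex.Re (chi g) / d),
                  Num.floor (complex.Im (chi g) / d))).
  rewrite /A pickleK /cell /= !in_itv/=.
  have cellP (x : R) : (Num.floor (x / d))%:~R * d <= x < (Num.floor (x / d) + 1)%:~R * d.
    by rewrite -(ler_pdivlMr _ _ d0) -(ltr_pdivrMr _ _ d0); exact: floor_itv.
  by split; exact: cellP.
have [k] := pettis bA covA; apply: filterS => h [g].
rewrite /A; case: unpickle => [[a b]|[]//] [[+ +] [+ +]]; rewrite /= !in_itv/=.
move=> /andP[a1 a2] /andP[b1 b2] /andP[a3 a4] /andP[b3 b4].
have : `|chi g - chi (g - h)| = `|chi h - 1|.
  rewrite -[RHS]mul1r -[X in _ = X * _](chi1 (g - h)) -normrM mulrBr mulr1 -chiM.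
  by rewrite -addrA addNr addr0.
move/(congr1 (fun z => complex.Re z ^+ 2)); rewrite !normc_def/=.
rewrite !sqr_sqrtr ?addr_ge0 ?sqr_ge0//.
case: (chi h) => x y; case: (chi g) a1 a2 b1 b2 => x1 y1.
case: (chi (g - h)) a3 a4 b3 b4 => x2 y2 /=.
rewrite !intrD !mulrDl oppr0 addr0 !mul1r => a3 a4 b3 b4 a1 a2 b1 b2 <-.
have h1 : (x1 - x2) ^+ 2 < d ^+ 2.
  rewrite -real_normK ?num_real// ltr_pXn2r ?nnegrE ?normr_ge0 ?ltW//.
  by rewrite ltr_norml; apply/andP; split; lra.
have h2 : (y1 - y2) ^+ 2 < d ^+ 2.
  rewrite -real_normK ?num_real// ltr_pXn2r ?nnegrE ?normr_ge0 ?ltW//.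
  by rewrite ltr_norml; apply/andP; split; lra.
apply: lt_trans (ltrD h1 h2) _; rewrite /d; have := exprn_gt0 2 e0; nra.
Qed.

End measurable_characters.

(** * Eigenpairs of kernels and characters of G *)

Section kernel_products.
Context {R : realType} {dX} {X : measurableType dX} {dY} {Y : measurableType dY}.
Variables (mu : probability X R) (nu : probability Y R).
Implicit Types (K L : X * Y * Y -> R).
Local Notation M := ((mu \x nu) \x nu)%E.

Lemma kmul_ae K L L' : bounded_measurable K -> bounded_measurable L ->
  bounded_measurable L' -> {ae M, forall p, L p = L' p} ->
  {ae M, forall p, kmul nu K L p = kmul nu K L' p}.
Proof.
move=> bK bL bL' LL'.
have mP : measurable [set p | L p = L' p].
  by apply: measurable_eqfun; [exact: bL.1|exact: bL'.1].
apply/(ae_fibers mu nu (P := fun p => kmul nu K L p = kmul nu K L' p)).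
  by apply: measurable_eqfun; apply: (bmeas_kmul mu nu _ _).1.
apply: filterS (ae_fibersW LL') => x.
move/(ae_fibers_swap nu x mP) => h; apply: aeW => y; apply: filterS h => y' h.
apply: Rint_ae; try exact: (bmeas_integrand (x, y, y') _ _).1.
by apply: filterS h => z /= ->.
Qed.

Lemma ae_last (P : Y -> Prop) : {ae nu, forall y, P y} ->
  {ae M, forall p : X * Y * Y, P p.2}.
Proof.
move=> [N [mN N0 PN]].
suff : {ae M, forall p : X * Y * Y, (~` N) p.2}.
  by apply: filterS => p nN; apply: contrapT => nP; apply: nN; apply: PN.
apply/(ae_fibers mu nu (P := fun p => (~` N) p.2)).
  by rewrite -[X in measurable X]setTI; apply: measurable_snd => //; exact: measurableC.
do 2 (apply: aeW => ?); exists N; split => // y /= nNy.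
by apply: contrapT => Ny; apply: nNy.
Qed.

(* Pairing L^T L with the kernel 1_C(y) 1_C(y') shows that the integral of L over
   [C] in its last variable vanishes. *)
Lemma kmul_transpose_eq0 L : bounded_measurable L ->
  {ae M, forall p, kmul nu (transpose L) L p = 0} -> {ae M, forall p, L p = 0}.
Proof.
move=> bL LL0; apply: rectangles_eq0 => // D C mD mC.
have b1 (B : set Y) : measurable B -> bounded_measurable (\1_B : Y -> R).
  exact: bmeas_indic.
pose h z : R := \int[nu]_y (\1_C y * L (z, y)).
have bCL : bounded_measurable (fun p : X * Y * Y => \1_C p.2 * L p : R).
  by apply: bmeasM => //; exact: (bmeas_comp measurable_snd (b1 C mC)).
have bh : bounded_measurable h by exact: (bmeas_Rint1 (mu \x nu)%E nu bCL).
pose N (p : X * Y * Y) : R := \1_C p.1.2 * \1_C p.2.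
have bN : bounded_measurable N.
  have m12 : measurable_fun [set: X * Y * Y] (fun p : X * Y * Y => p.1.2).
    exact: measurableT_comp.
  apply: bmeasM; first exact: (bmeas_comp m12 (b1 C mC)).
  exact: (bmeas_comp measurable_snd (b1 C mC)).
have bT := bmeas_transpose bL.
have h0 : {ae (mu \x nu)%E, forall z, h z = 0}.
  apply: Rint_sqr_eq0 => //.
  have : inner mu nu (kmul nu (transpose L) L) N = 0.
    rewrite (inner_ae (K' := fun=> 0) (L' := N) _ _ _ _ LL0)//.
    - by rewrite /inner; under eq_Rintegral do rewrite mul0r; rewrite Rint_cst.
    - exact: bmeas_kmul.
    - exact: bmeas_cst.
    - exact: aeW.
  rewrite inner_kmull//.
  have -> : transpose (transpose L) = L by apply/funext => -[[]].
  (* Pairing this with [L] over [y'] produces a second factor [h (x, z)], so the vanishing inner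
     product is the integral of [h ^+ 2]. *)
  have LN x z y' : kmul nu L N (x, z, y') = h (x, z) * \1_C y'.
    rewrite /kmul/= -RintZr; last exact: (bmeas_pair1 (x, z) bCL).
    by apply: eq_Rintegral => y _; rewrite /N/=; ring.
  rewrite /inner Rint_prod1; last by apply: bmeasM => //; exact: bmeas_kmul.
  move=> <-; apply: eq_Rintegral => -[x z] _ /=.
  under [RHS]eq_Rintegral do rewrite LN.
  rewrite expr2 [X in _ * X]/h -RintZl; last exact: (bmeas_pair1 (x, z) bCL).
  by apply: eq_Rintegral => y _; ring.
rewrite Rint_prod1; last first.
  have bD : bounded_measurable (\1_D : X * Y -> R) by exact: bmeas_indic.
  apply: bmeasM => //; apply: bmeasM; first exact: (bmeas_comp measurable_fst bD).
  exact: (bmeas_comp measurable_snd (b1 C mC)).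
have bDh : bounded_measurable (fun z => \1_D z * h z).
  by apply: bmeasM => //; exact: bmeas_indic.
transitivity (\int[(mu \x nu)%E]_z (\1_D z * h z)).
  apply: eq_Rintegral => z _; rewrite /h -RintZl; last exact: (bmeas_pair1 z bCL).
  by apply: eq_Rintegral => y _ /=; rewrite mulrA.
rewrite -[RHS](Rint_cst (mu \x nu)%E 0); apply: Rint_ae => //; first exact: bDh.1.
by apply: filterS h0 => z ->; rewrite mulr0.
Qed.

(** Supplies both positivity conditions of the power iteration: once for the centred indicator, and
    once for the symmetric kernel built from it. *)
Lemma inner_kmul_transpose_gt0 L : bounded_measurable L ->
  ~ {ae M, forall p, L p = 0} ->
  0 < inner mu nu (kmul nu (transpose L) L) (kmul nu (transpose L) L).
Proof.
move=> bL L0; rewrite lt_neqAle inner_ge0 andbT eq_sym; apply/eqP => i0.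
apply: L0; apply: kmul_transpose_eq0 => //; apply: inner_eq0 i0.
by apply: bmeas_kmul => //; exact: bmeas_transpose.
Qed.

End kernel_products.

Section group_eigenpairs.
Context {R : realType} {G : topologicalZmodType}.
Context {dX} {X : measurableType dX} {dY} {Y : measurableType dY}.
Variables (mu : probability X R) (nu : probability Y R) (S : G -> Y -> Y).
Hypotheses (lcscG : lcsc_group G) (actS : group_action nu S).
Local Notation M := ((mu \x nu) \x nu)%E.
Local Notation "<< K , L >>" := (inner mu nu K L).
Implicit Types (K L : X * Y * Y -> R).

Lemma group_action_measurable g : measurable_fun [set: Y] (S g).
Proof. by case: actS => + _ _ => /(_ g)[]. Qed.

Lemma group_action_preserving g A : measurable A -> nu (S g @^-1` A) = nu A.
Proof. by case: actS => + _ _ => /(_ g)[_ + _]; apply. Qed.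

Lemma group_action_comm g h : {ae nu, forall y, S g (S h y) = S h (S g y)}.
Proof.
case: actS => _ Sadd _; apply: filterS2 (Sadd g h) (Sadd h g) => y <- <-.
by rewrite addrC.
Qed.

Lemma measurable_inner_act K L : bounded_measurable K -> bounded_measurable L ->
  measurable_fun [set: borel G]
    ((fun g => <<act (S g) K, L>>) : borel G -> R).
Proof.
move=> bK bL; have [_ _ mS] := actS.
pose F (q : borel G * (X * Y * Y)) : R := K (q.2.1, S q.1 q.2.2) * L q.2.
have mp : measurable_fun [set: borel G * (X * Y * Y)]
    (fun q : borel G * (X * Y * Y) => (q.2.1, S q.1 q.2.2)).
  apply: measurable_fun_pair; first exact: measurableT_comp.
  apply: (measurableT_comp (f := fun q : borel G * Y => S q.1 q.2) mS
    (g := fun q : borel G * (X * Y * Y) => (q.1, q.2.2))).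
  by apply: measurable_fun_pair => //; exact: measurableT_comp.
have bF : bounded_measurable F.
  apply: bmeasM; first exact: (bmeas_comp mp bK).
  exact: (bmeas_comp measurable_snd bL).
(* The measurability lemma takes a probability on the parameter space, absent from its conclusion; a
   Dirac mass provides one. *)
exact: (bmeas_Rint1 (@dirac _ (borel G) (0 : G) R) M bF).1.
Qed.

(** For F = H1 + i H2 the eigenvalue at [g] is the quotient of the Hermitian product of [act (S g)]
    F with F by the squared norm of F; [re] and [im] are its two parts. It is therefore unique,
    which yields multiplicativity, and measurable in [g], which yields continuity. Its modulus is 1
    because [S g] preserves norms. *)
Lemma eigenpair_character (H1 H2 : X * Y * Y -> R) :
  bounded_measurable H1 -> bounded_measurable H2 ->
  0 < <<H1, H1>> + <<H2, H2>> ->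
  (forall g, exists a b, {ae M, forall p,
    act (S g) H1 p = a * H1 p - b * H2 p /\
    act (S g) H2 p = a * H2 p + b * H1 p}) ->
  exists2 chi, character chi & forall g, {ae M, forall p,
    act (S g) H1 p = complex.Re (chi g) * H1 p - complex.Im (chi g) * H2 p /\
    act (S g) H2 p = complex.Re (chi g) * H2 p + complex.Im (chi g) * H1 p}.
Proof.
move=> b1 b2; set n2 := <<H1, H1>> + <<H2, H2>> => n2_gt0 eig.
have n2_neq0 : n2 != 0 by rewrite gt_eqF.
have bact g K : bounded_measurable K -> bounded_measurable (act (S g) K).
  by apply: act_bmeas; exact: group_action_measurable.
pose re g := (<<act (S g) H1, H1>> + <<act (S g) H2, H2>>) / n2.
pose im g := (<<act (S g) H2, H1>> - <<act (S g) H1, H2>>) / n2.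
have bab a b K L : bounded_measurable K -> bounded_measurable L ->
    bounded_measurable (fun p => a * K p + b * L p).
  by move=> bK bL; apply: bmeasD; exact: bmeasZ.
have innerab a b K L N : bounded_measurable K -> bounded_measurable L ->
    bounded_measurable N ->
    <<fun p => a * K p + b * L p, N>> = a * <<K, N>> + b * <<L, N>>.
  by move=> bK bL bN; rewrite innerDl ?innerZl//; exact: bmeasZ.
have innersq a b K L : bounded_measurable K -> bounded_measurable L ->
    <<fun p => a * K p + b * L p, fun p => a * K p + b * L p>> =
    a ^+ 2 * <<K, K>> + 2 * a * b * <<K, L>> + b ^+ 2 * <<L, L>>.
  move=> bK bL; have bKL := bab a b K L bK bL.
  have eS N : bounded_measurable N ->
      <<N, fun p => a * K p + b * L p>> = a * <<K, N>> + b * <<L, N>>.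
    by move=> bN; rewrite innerC innerab.
  by rewrite innerab// !eS// (innerC _ _ L K); ring.
have uniq_ab g a b : {ae M, forall p,
    act (S g) H1 p = a * H1 p - b * H2 p /\
    act (S g) H2 p = a * H2 p + b * H1 p} -> a = re g /\ b = im g.
  move=> h.
  have e1 N : bounded_measurable N ->
      <<act (S g) H1, N>> = a * <<H1, N>> + (- b) * <<H2, N>>.
    move=> bN; rewrite -innerab//; apply: inner_ae => //;
      [exact: bact|exact: bab| |exact: aeW].
    by apply: filterS h => p [-> _]; rewrite mulNr.
  have e2 N : bounded_measurable N ->
      <<act (S g) H2, N>> = a * <<H2, N>> + b * <<H1, N>>.
    move=> bN; rewrite -innerab//; apply: inner_ae => //;
      [exact: bact|exact: bab| |exact: aeW].
    by apply: filterS h => p [_ ->].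
  have c12 := innerC mu nu H1 H2.
  by rewrite /re /im !e1// !e2// c12 /n2; split; field.
have eigE g : {ae M, forall p,
    act (S g) H1 p = re g * H1 p - im g * H2 p /\
    act (S g) H2 p = re g * H2 p + im g * H1 p}.
  by have [a [b h]] := eig g; have [<- <-] := uniq_ab g a b h.
pose chi g : R[i] := (re g +i* im g)%C.
have chiM g h : chi (g + h) = chi g * chi h.
  have [] := uniq_ab (g + h) (re g * re h - im g * im h) (re g * im h + im g * re h).
    have [_ Sadd _] := actS.
    have acth := act_ae (group_action_measurable h) (@group_action_preserving h) (eigE g).
    have Sgh : {ae M, forall p : X * Y * Y, S (g + h) p.2 = S g (S h p.2)}.
      exact: ae_last (Sadd g h).
    apply: filterS3 (eigE h) acth Sgh => p [eh1 eh2] [eg1 eg2] Sp.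
    move: eg1 eg2; rewrite /act/= -Sp => -> ->.
    move: eh1 eh2; rewrite /act => -> ->.
    by split; ring.
  by move=> e1 e2; rewrite /chi -e1 -e2.
have chi1 g : `|chi g| = 1.
  have pos0 : re g ^+ 2 + im g ^+ 2 = 1.
    have mg := group_action_measurable g.
    have pg := @group_action_preserving g.
    have : <<act (S g) H1, act (S g) H1>> + <<act (S g) H2, act (S g) H2>> = n2.
      by rewrite !inner_act.
    have bE1 := bab (re g) (- im g) _ _ b1 b2; have bE2 := bab (re g) (im g) _ _ b2 b1.
    have E1 : {ae M, forall p, act (S g) H1 p = re g * H1 p + (- im g) * H2 p}.
      by apply: filterS (eigE g) => p [-> _]; rewrite mulNr.
    have E2 : {ae M, forall p, act (S g) H2 p = re g * H2 p + im g * H1 p}.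
      by apply: filterS (eigE g) => p [_ ->].
    rewrite (inner_ae (bact _ _ b1) bE1 (bact _ _ b1) bE1 E1 E1).
    rewrite (inner_ae (bact _ _ b2) bE2 (bact _ _ b2) bE2 E2 E2).
    rewrite !innersq// (innerC _ _ H2 H1).
    move=> h; apply: (mulIf n2_neq0); rewrite mul1r -[RHS]h /n2; ring.
  by rewrite normc_def/= pos0 sqrtr1.
exists chi => //; split => //.
apply: measurable_character_continuous => //.
- rewrite (_ : (fun g => _) = re)//.
  apply: measurable_funM; last exact: measurable_cst.
  by apply: measurable_funD; exact: measurable_inner_act.
- rewrite (_ : (fun g => _) = im)//.
  apply: measurable_funM; last exact: measurable_cst.
  by apply: measurable_funB; exact: measurable_inner_act.
Qed.

End group_eigenpairs.

Lemma bmeas_Lfun2 {R : realType} d (T : measurableType d) (m : probability T R)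
  (f : T -> R) : bounded_measurable f -> f \in Lfun m 2%:E.
Proof.
move=> bf; rewrite inE; apply/andP; split; first by rewrite inE; exact: bf.1.
rewrite inE/= /finite_norm unlock /Lnorm; apply: poweR_lty.
rewrite (eq_integral (EFin \o (fun x => f x ^+ 2))); last first.
  move=> x _ /=; rewrite powR_mulrn// real_normK ?num_real//.
have := integrable_fin_num measurableT (bmeas_integrable m (bmeasX 2 bf)).
by rewrite ge0_fin_numE// integral_ge0// => x _; rewrite lee_fin sqr_ge0.
Qed.

(** * Relative weak mixing *)

Section main.
Context {R : realType} {G : topologicalZmodType}.
Context {dX} {X : measurableType dX} {dY} {Y : measurableType dY}.
Variables (mu : probability X R) (nu : probability Y R).
Variables (T : X -> X) (phi : X -> G) (S : G -> Y -> Y).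
Hypotheses (lcscG : lcsc_group G) (mT : measurable_fun [set: X] T).
Hypotheses (mphi : measurable_fun [set: X] (phi : X -> borel G))
  (actS : group_action nu S).
Local Notation M := ((mu \x nu) \x nu)%E.
Local Notation "<< K , L >>" := (inner mu nu K L).

Let s x := S (phi x).

Let ms x : measurable_fun [set: Y] (s x).
Proof. exact: group_action_measurable actS _. Qed.

Let s_nu x A : measurable A -> nu (s x @^-1` A) = nu A.
Proof. exact: group_action_preserving actS _ _. Qed.

Lemma measurable_skew_product : measurable_fun [set: X * Y]
  (fun p => (T p.1, s p.1 p.2)).
Proof.
have [_ _ mS] := actS.
apply: measurable_fun_pair; first exact: measurableT_comp.
apply: (measurableT_comp (f := fun q : borel G * Y => S q.1 q.2) mS
  (g := fun p : X * Y => (phi p.1 : borel G, p.2))).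
apply: measurable_fun_pair => //.
exact: (measurableT_comp (f := phi : X -> borel G) mphi measurable_fst).
Qed.

Let mskew := measurable_skew_product.

Lemma ergodic_skew_of_square : relatively_weakly_mixing mu nu T phi S ->
  ergodic (mu \x nu)%E (skew_product T phi S).
Proof.
move=> erg A mA A0.
have fstE (B : set (X * Y)) : measurable B ->
    M ((@fst (X * Y) Y) @^-1` B) = (mu \x nu)%E B.
  move=> mB; rewrite (_ : _ @^-1` B = B `*` [set: Y]); last first.
    by apply/seteqP; split => p //= [].
  rewrite product_measure1E// -[RHS]mule1; congr (_ * _)%E.
  exact: probability_setT.
have mA' : measurable ((@fst (X * Y) Y) @^-1` A).
  by rewrite -[X in measurable X]setTI; exact: measurable_fst.
have [|A_0|A_1] := erg _ mA'; last first.
- by right; exact: etrans (esym (fstE A mA)) A_1.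
- by left; exact: etrans (esym (fstE A mA)) A_0.
have mskewA : measurable (skew_product T phi S @^-1` A).
  by rewrite -[X in measurable X]setTI; exact: mskew.
apply: etrans (fstE ((skew_product T phi S @^-1` A) `+` A) _) A0.
by apply: measurableU; exact: measurableD.
Qed.

Lemma weakly_mixing_of_square : relatively_weakly_mixing mu nu T phi S ->
  weakly_mixing nu S.
Proof.
move=> erg f [[reL imL] f_neq0 [chi [_ _ chi1] fchi]].
pose a y := complex.Re (f y); pose b y := complex.Im (f y).
have ma : measurable_fun [set: Y] a by move/andP: reL => [+ _]; rewrite inE.
have mb : measurable_fun [set: Y] b by move/andP: imL => [+ _]; rewrite inE.
have m2 (g : Y -> R) : measurable_fun [set: Y] g ->
    measurable_fun [set: X * Y * Y] (fun p : X * Y * Y => g p.1.2).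
  by move=> mg; apply: measurableT_comp => //; exact: measurableT_comp.
have m3 (g : Y -> R) : measurable_fun [set: Y] g ->
    measurable_fun [set: X * Y * Y] (fun p : X * Y * Y => g p.2).
  by move=> mg; exact: measurableT_comp.
(* For an eigenfunction f, the function f(y) conj f(y') is invariant. *)
pose F (p : X * Y * Y) := f p.1.2 * (f p.2)^*%C.
pose F1 (p : X * Y * Y) := a p.1.2 * a p.2 + b p.1.2 * b p.2.
pose F2 (p : X * Y * Y) := b p.1.2 * a p.2 - a p.1.2 * b p.2.
have FE p : F p = (F1 p +i* F2 p)%C.
  apply/eqP; rewrite eq_complex /F complex_ReM complex_ImM /F1 /F2 /a /b /=.
  by case: (f p.1.2) (f p.2) => [x y] [x' y'] /=; apply/andP; split; apply/eqP; ring.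
have mF1 : measurable_fun [set: X * Y * Y] F1.
  by apply: measurable_funD; apply: measurable_funM;
    [exact: m2|exact: m3|exact: m2|exact: m3].
have mF2 : measurable_fun [set: X * Y * Y] F2.
  by apply: measurable_funB; apply: measurable_funM;
    [exact: m2|exact: m3|exact: m2|exact: m3].
have msq := measurable_square mskew.
have Finv : {ae mu, forall x, {ae nu, forall y, {ae nu, forall y',
    F (relative_square T phi S (x, y, y')) = F (x, y, y')}}}.
  (* The eigenvalue relation is applied at [phi x], in [y] and in [y']; its null set depends on [x],
     hence the nested quantifiers. *)
  apply: aeW => x; have h := fchi (phi x); apply: filterS (h) => y fy.
  apply: filterS (h) => y' fy'; rewrite /F/= fy fy' rmorphM mulrACA.
  by rewrite -normCK chi1 expr1n mul1r.
have const (H : X * Y * Y -> R) : measurable_fun [set: X * Y * Y] H ->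
    {ae mu, forall x, {ae nu, forall y, {ae nu, forall y',
      H (relative_square T phi S (x, y, y')) = H (x, y, y')}}} ->
    exists c, {ae M, forall p, H p = c}.
  move=> mH iH; apply: (ergodic_ae_const erg) => //.
  apply/(ae_fibers mu nu (P := fun p => H (relative_square T phi S p) = H p)) => //.
  apply: measurable_eqfun => //; exact: (measurableT_comp mH msq).
have [c1 h1] : exists c, {ae M, forall p, F1 p = c}.
  apply: const => //; apply: filterS Finv => x; apply: filterS => y.
  by apply: filterS => y'; rewrite !FE => -[].
have [c2 h2] : exists c, {ae M, forall p, F2 p = c}.
  apply: const => //; apply: filterS Finv => x; apply: filterS => y.
  by apply: filterS => y'; rewrite !FE => -[].
have FC : {ae M, forall p, F p = (c1 +i* c2)%C}.
  by apply: filterS2 h1 h2 => p <- <-.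
have [x hx] := ae_ex (ae_fibersW FC).
pose P y := {ae nu, forall y', F (x, y, y') = (c1 +i* c2)%C}.
(* With such a [y] fixed, the product of [f y] and the conjugate of [f y'] is constant in almost
   every [y'], and division by [f y] determines [f y']. *)
have [y [Py fy]] : exists y, P y /\ f y != 0.
  apply: contrapT => /forallNP h; apply: f_neq0; apply: filterS hx => y Py.
  by apply: contrapT => /eqP fy; exact: (h y).
exists (((c1 +i* c2)%C / f y)^*%C); apply: filterS Py => y' <-.
by rewrite /F/= mulrAC mulfV// mul1r conjcK.
Qed.

Section converse.
Hypothesis erg : ergodic (mu \x nu)%E (fun p => (T p.1, s p.1 p.2)).
Hypothesis wm : weakly_mixing nu S.
Local Notation invariant := (invariant_kernel mu nu T s).

(* Averaging the complex kernel H1 + i H2 over its first two variables in a set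
   [D] gives an eigenfunction of the action, constant by weak mixing. *)
Lemma eigenpair_ae_const (chi : G -> R[i]) (H1 H2 : X * Y * Y -> R) :
  character chi -> invariant H1 -> invariant H2 ->
  (forall g, {ae M, forall p,
    act (S g) H1 p = complex.Re (chi g) * H1 p - complex.Im (chi g) * H2 p /\
    act (S g) H2 p = complex.Re (chi g) * H2 p + complex.Im (chi g) * H1 p}) ->
  {ae M, forall p, H1 p = \int[M]_p H1 p} /\
  {ae M, forall p, H2 p = \int[M]_p H2 p}.
Proof.
move=> chiP i1 i2 eig; have [[b1 _] [b2 _]] := (i1, i2).
pose section (D : set (X * Y)) (H : X * Y * Y -> R) y : R :=
  \int[(mu \x nu)%E]_z (\1_D z * H (z, y)).
have bDH D H : measurable D -> bounded_measurable H ->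
    bounded_measurable (fun p : X * Y * Y => \1_D p.1 * H p : R).
  move=> mD bH; apply: bmeasM => //.
  exact: (bmeas_comp measurable_fst (bmeas_indic mD)).
have bsec D H : measurable D -> bounded_measurable H ->
    bounded_measurable (section D H).
  by move=> mD bH; exact: (bmeas_Rint2 (mu \x nu)%E nu (bDH D H mD bH)).
have const D : measurable D -> exists c1 c2,
    {ae nu, forall y, section D H1 y = c1 /\ section D H2 y = c2}.
  move=> mD.
  pose f y : R[i] := (section D H1 y +i* section D H2 y)%C.
  suff [[c1 c2] h] : exists c, {ae nu, forall y, f y = c}.
    by exists c1, c2; apply: filterS h => y [-> ->].
  (* Eigenfunctions are nonzero by definition, so a vanishing average is treated apart. *)
  have [f0|f_neq0] := pselect {ae nu, forall y, f y = 0}; first by exists 0.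
  apply: wm; split => //.
    by split; apply: bmeas_Lfun2; exact: bsec.
  exists chi => // g.
  have mg := group_action_measurable actS g.
  have mP : measurable [set p : X * Y * Y |
      act (S g) H1 p = complex.Re (chi g) * H1 p - complex.Im (chi g) * H2 p /\
      act (S g) H2 p = complex.Re (chi g) * H2 p + complex.Im (chi g) * H1 p].
    apply: measurableI; apply: measurable_eqfun.
    - exact: (act_bmeas mg b1).1.
    - by apply: (bmeasB _ _).1; exact: bmeasZ.
    - exact: (act_bmeas mg b2).1.
    - by apply: (bmeasD _ _).1; exact: bmeasZ.
  have := eig g; move/(ae_prod (mu \x nu)%E nu mP).
  move/(ae_prod_swap (mu \x nu)%E nu mP); apply: filterS => y h.
  have bs (H : X * Y * Y -> R) : bounded_measurable H ->
      bounded_measurable (fun z => \1_D z * H (z, y)).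
    by move=> bH; exact: (bmeas_pair2 y (bDH D H mD bH)).
  have bsg (H : X * Y * Y -> R) : bounded_measurable H ->
      bounded_measurable (fun z => \1_D z * H (z, S g y)).
    by move=> bH; exact: (bmeas_pair2 (S g y) (bDH D H mD bH)).
  have e1 : section D H1 (S g y) = complex.Re (chi g) * section D H1 y -
      complex.Im (chi g) * section D H2 y.
    rewrite /section -(RintZl _ _ (bs _ b1)) -(RintZl _ _ (bs _ b2)).
    rewrite -(RintB _ (bmeasZ _ (bs _ b1)) (bmeasZ _ (bs _ b2))).
    apply: Rint_ae; first exact: (bsg _ b1).1.
      by apply: (bmeasB _ _).1; apply: bmeasZ; exact: bs.
    by apply: filterS h => z [+ _]; rewrite /act/= => ->; ring.
  have e2 : section D H2 (S g y) = complex.Re (chi g) * section D H2 y +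
      complex.Im (chi g) * section D H1 y.
    rewrite /section -(RintZl _ _ (bs _ b2)) -(RintZl _ _ (bs _ b1)).
    rewrite -(RintD _ (bmeasZ _ (bs _ b2)) (bmeasZ _ (bs _ b1))).
    apply: Rint_ae; first exact: (bsg _ b2).1.
      by apply: (bmeasD _ _).1; apply: bmeasZ; exact: bs.
    by apply: filterS h => z [_]; rewrite /act/= => ->; ring.
  by rewrite /f e1 e2; case: (chi g) => u v.
suff main H : invariant H ->
    (forall D, measurable D -> exists c, {ae nu, forall y, section D H y = c}) ->
    {ae M, forall p, H p = \int[M]_p H p}.
  split; apply: main => // D mD; have [c1 [c2 h]] := const D mD.
    by exists c1; apply: filterS h => y [].
  by exists c2; apply: filterS h => y [].
move=> iH constH; have bH := iH.1; set k := \int[M]_p H p.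
have bHk : bounded_measurable (fun p => H p - k).
  by apply: bmeasB => //; exact: bmeas_cst.
suff : {ae M, forall p, H p - k = 0} by apply: filterS => p /subr0_eq.
apply: rectangles_eq0 => // D C mD mC.
have bC : bounded_measurable (\1_C : Y -> R) by exact: bmeas_indic.
have bD : bounded_measurable (\1_D : X * Y -> R) by exact: bmeas_indic.
have bDp : bounded_measurable (fun p : X * Y * Y => \1_D p.1 : R).
  exact: (bmeas_comp measurable_fst bD).
have bCp : bounded_measurable (fun p : X * Y * Y => \1_C p.2 : R).
  exact: (bmeas_comp measurable_snd bC).
have [c hc] := constH D mD.
(* The constant is found by integrating over [y] as well: by Fubini and ergodicity, the integral of
   [H (z, _)] is [k] for almost every [z]. Hence [H - k] has integral zero over every rectangle. *)
have cE : c = k * \int[(mu \x nu)%E]_z \1_D z.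
  rewrite -[LHS](Rint_cst nu); transitivity (\int[nu]_y section D H y).
    apply: Rint_ae => //; first exact: (bsec D H mD bH).1.
    by apply: filterS hc => y ->.
  rewrite -(Rint_prod2 (mu \x nu)%E nu (bDH D H mD bH)) (Rint_prod1 _ _ (bDH D H mD bH)).
  rewrite -RintZl//; apply: Rint_ae.
  - exact: (bmeas_Rint1 (mu \x nu)%E nu (bDH D H mD bH)).1.
  - exact: (bmeasZ k bD).1.
  - apply: filterS (fiber_last ms s_nu mskew erg iH) => z hz /=.
    by rewrite RintZl ?hz 1?mulrC//; exact: bmeas_pair1.
rewrite Rint_prod2; last by apply: bmeasM => //; exact: bmeasM.
rewrite -[RHS](Rint_cst nu 0); apply: Rint_ae => //.
  apply: (bmeas_Rint2 (mu \x nu)%E nu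
    (f := fun p => \1_D p.1 * \1_C p.2 * (H p - k)) _).1.
  by apply: bmeasM => //; exact: bmeasM.
apply: filterS hc => y hy.
transitivity (\1_C y * (section D H y - k * \int[(mu \x nu)%E]_z \1_D z)).
  rewrite /section -RintZl// -RintB;
    [|exact: (bmeas_pair2 y (bDH D H mD bH))|exact: bmeasZ].
  rewrite -RintZl; first by apply: eq_Rintegral => z _ /=; ring.
  by apply: bmeasB; [exact: (bmeas_pair2 y (bDH D H mD bH))|exact: bmeasZ].
by rewrite hy cE subrr mulr0.
Qed.

Lemma square_ergodic : relatively_weakly_mixing mu nu T phi S.
Proof.
move=> A mA A0.
have bA : bounded_measurable (\1_A : X * Y * Y -> R) by exact: bmeas_indic.
pose sq := relative_square T phi S.
have iA : invariant (\1_A : X * Y * Y -> R).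
  apply: invariant_of_ae => //.
  have msqA : measurable (sq @^-1` A).
    by rewrite -[X in measurable X]setTI; exact: (measurable_square mskew).
  have : M.-negligible ((sq @^-1` A) `+` A).
    by apply/negligibleP => //; apply: measurableU; exact: measurableD.
  apply: negligibleS => p /= ne; apply: contrapT => /not_orP[n1 n2].
  apply: ne; rewrite !indicE; congr ((nat_of_bool _)%:R).
  apply/idP/idP; rewrite !in_setE => h; apply: contrapT => nh.
    by apply: n1; split.
  by apply: n2; split.
pose c := \int[M]_p (\1_A p : R).
have iL : invariant (fun p => \1_A p - c).
  by apply: invariantB => //; exact: invariant_cst.
set L := (fun p => _) in iL.
have bL := iL.1.
have intL : \int[M]_p L p = 0.
  by rewrite RintB//; [rewrite Rint_cst subrr|exact: bmeas_cst].
have [L0|L_neq0] := pselect {ae M, forall p, L p = 0}.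
  (* A single point where [L] vanishes shows that [c] is 1 or 0, and then [A] is conull or null. *)
  have [p] := ae_ex L0; rewrite /L indicE => /subr0_eq.
  case: (p \in A) => /= cE; [right|left].
    have : {ae M, forall p, A p}.
      apply: filterS L0 => q; rewrite /L -cE indicE; case: (boolP (q \in A)) => [|_].
        by rewrite in_setE.
      by move/eqP; rewrite /= sub0r oppr_eq0 oner_eq0.
    move/(aeP M mA) => nA0; rewrite -(setCK A) probability_setC ?nA0 ?sube0//.
    exact: measurableC.
  have : {ae M, forall p, (~` A) p}.
    apply: filterS L0 => q; rewrite /L -cE indicE subr0 => /eqP.
    by case: (boolP (q \in A)) => [|/negP]; rewrite ?oner_eq0// in_setE.
  move/(aeP M (measurableC mA)) => nA0; rewrite -[RHS]nA0; congr (M _).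
  by apply/seteqP; split => q /=; [move=> Aq; exact|move/contrapT].
exfalso.
have iLT := invariant_transpose mskew iL.
pose B := kmul nu (transpose L) L.
have iB : invariant B by exact: (invariant_kmul ms s_nu mskew).
have bB := iB.1.
have symB : transpose B = B.
  by rewrite /B transpose_kmul (_ : transpose (transpose L) = L)//; apply/funext => -[[]].
have B_gt0 : 0 < <<B, B>> by exact: inner_kmul_transpose_gt0.
have BB_gt0 : 0 < <<kmul nu B B, kmul nu B B>>.
  rewrite -{1 3}symB; apply: inner_kmul_transpose_gt0 => // B0.
  move: B_gt0; rewrite (inner_ae (K' := fun=> 0) (L' := B) bB (bmeas_cst 0) bB bB B0).
    by rewrite /inner; under eq_Rintegral do rewrite mul0r; rewrite Rint_cst ltxx.
  exact: aeW.
have [l l0 [P [iP eP P_neq0]]] :=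
  eigenkernel_exists ms s_nu mskew erg iB symB B_gt0 BB_gt0.
set Q := kmul nu B B in eP.
have iQ : invariant Q by exact: (invariant_kmul ms s_nu mskew).
(* Commutativity of [G] is used twice: [S g] commutes with [S (phi x)], so that it acts on the
   eigenspace, and the maps [S g] commute with one another, so that a common eigenvector exists. *)
have [H1 [H2 [[i1 e1] [i2 e2] n2_gt0 eig]]] :=
  common_eigenpair ms s_nu mskew erg (group_action_measurable actS)
    (group_action_preserving actS) (fun g x => group_action_comm actS g (phi x))
    (group_action_comm actS) iQ l0 (conj iP eP) P_neq0.
have [chi chiP chiE] := eigenpair_character lcscG actS i1.1 i2.1 n2_gt0 eig.
have [h1 h2] := eigenpair_ae_const chiP i1 i2 chiE.
(* Applied to 1, [L] gives its row integrals, which by ergodicity equal its total integral, zero by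
   the choice of [c]. *)
have L1 : {ae M, forall p, kmul nu L (fun=> 1) p = 0}.
  apply/(ae_fibers mu nu (P := fun p => kmul nu L (fun=> 1) p = 0)).
    apply: measurable_eqfun; last exact: measurable_cst.
    by apply: (bmeas_kmul mu nu bL _).1; exact: bmeas_cst.
  apply: filterS (fiber_lastP ms s_nu mskew erg iL) => x; apply: filterS => y h.
  apply: aeW => y'; rewrite /kmul/= -[RHS]intL -h.
  by apply: eq_Rintegral => z _; rewrite mulr1.
have kmul0 K : bounded_measurable K -> kmul nu K (fun=> 0) = fun=> 0.
  move=> bK; apply/funext => p; rewrite /kmul.
  by under eq_Rintegral do rewrite mulr0; rewrite Rint_cst.
have kmul_ae0 K N : bounded_measurable K -> bounded_measurable N ->
    {ae M, forall p, N p = 0} -> {ae M, forall p, kmul nu K N p = 0}.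
  by move=> bK bN N0; have := kmul_ae bK bN (bmeas_cst 0) N0; rewrite kmul0.
have B1 : {ae M, forall p, kmul nu B (fun=> 1) p = 0}.
  rewrite /B kmulA//; [|exact: iLT.1|exact: bmeas_cst].
  apply: kmul_ae0 L1; first exact: iLT.1.
  by apply: bmeas_kmul => //; exact: bmeas_cst.
have Q1 : {ae M, forall p, kmul nu Q (fun=> 1) p = 0}.
  rewrite /Q kmulA//; last exact: bmeas_cst.
  by apply: kmul_ae0 B1 => //; apply: bmeas_kmul => //; exact: bmeas_cst.
have zero H : invariant H -> {ae M, forall p, kmul nu Q H p = l * H p} ->
    {ae M, forall p, H p = \int[M]_p H p} -> {ae M, forall p, H p = 0}.
  move=> iH eH; set k := \int[M]_p H p => hk.
  have bk : bounded_measurable (fun p : X * Y * Y => k * 1).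
    exact: bmeas_cst.
  have hk' : {ae M, forall p, H p = k * 1} by apply: filterS hk => p ->; rewrite mulr1.
  have := kmul_ae iQ.1 iH.1 bk hk'.
  rewrite kmulZr; [|exact: iQ.1|exact: bmeas_cst].
  apply: filterS3 eH Q1 => p -> -> /eqP.
  by rewrite mulr0 mulf_eq0 gt_eqF//= => /eqP.
have inner0 H : bounded_measurable H -> {ae M, forall p, H p = 0} -> <<H, H>> = 0.
  move=> bH H0; rewrite (inner_ae (K' := fun=> 0) (L' := H) bH (bmeas_cst 0) bH bH H0).
    by rewrite /inner; under eq_Rintegral do rewrite mul0r; rewrite Rint_cst.
  exact: aeW.
move: n2_gt0; rewrite (inner0 H1 i1.1 (zero H1 i1 e1 h1)).
by rewrite (inner0 H2 i2.1 (zero H2 i2 e2 h2)) addr0 ltxx.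
Qed.

End converse.
End main.

Theorem proposition7 (R : realType)
    (dX : measure_display) (X : measurableType dX) (mu : probability X R)
    (dY : measure_display) (Y : measurableType dY) (nu : probability Y R)
    (G : topologicalZmodType)
    (T : X -> X) (phi : X -> G) (S : G -> Y -> Y)
    (hX : standard_borel R X) (hY : standard_borel R Y)
    (hG : lcsc_group G)
    (hT : automorphism mu T)
    (hphi : measurable_fun [set: X] (phi : X -> borel G))
    (hS : group_action nu S) :
  relatively_weakly_mixing mu nu T phi S <->
  ergodic (mu \x nu)%E (skew_product T phi S) /\ weakly_mixing nu S.
Proof.
have [mT _ _] := hT; split.
  by move=> erg; split;
    [exact: ergodic_skew_of_square erg|exact: weakly_mixing_of_square erg].
by move=> [erg wm]; exact: square_ergodic.
Qed.
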